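(* Let $(\mathcal A,\tau)$ be an algebraic traffic space, $\Phi$ the trace associated to $\tau$ and $\Psi=\Phi\circ\deg$. (1) An element $a$ of $\mathcal A$ is traffic independent from itself if and only if it has the same traffic distribution as $\Phi(a)\,\mathbb I+(\Psi(a)-\Phi(a))\,\mathbb J$. (2) (Law of large numbers.) Let $(a_n)_{n\ge1}$ be a sequence of identically distributed (traffic) independent elements of $\mathcal A$ and let $a$ be distributed as the $a_n$'s. For $n\ge1$ let $m_n=\frac{a_1+\dots+a_n}n$. Then, as $n\to\infty$, $m_n$ converges to $\Phi(a)\,\mathbb I+(\Psi(a)-\Phi(a))\,\mathbb J$ in traffic distribution.
   Context: Graphs are finite, connected, directed, with nonempty vertex set; loops, multiple edges and empty edge set are allowed. $\mathcal G$-algebras. A graph operation with $K$ edges is a graph $g$ with $K$ edges numbered $1,\dots,K$ and two vertices $in,out$ (possibly equal). A $\mathcal G$-algebra is a complex vector space $\mathcal A$ with, for each graph operation $g$ with $K$ edges, a linear map $Z_g:\mathcal A^{\otimes K}\to\mathcal A$ (an element of $\mathcal A$ if $K=0$) such that: $Z_{(\cdot\leftarrow\cdot)}=\mathrm{id}$ for the graph with two vertices $in\neq out$ and one edge from $in$ to $out$; $Z_g(a_1\otimes\dots\otimes a_K)$ depends only on which element is placed on which edge, not on the numbering; and $Z_g(Z_{g_1}\otimes\dots\otimes Z_{g_K})=Z_{g(g_1,\dots,g_K)}$, where the $k$-th edge of $g$ is replaced by $g_k$, input (resp. output) of $g_k$ being identified with the source (resp. target) of the edge. $\mathbb I=Z_{(\cdot)}$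 comes from the one-vertex graph without edges; $\deg(a)$ is $Z$ of the graph with two vertices $in=out$ and $v$ and one edge from $v$ to $in=out$ labeled $a$. Traffic spaces. A test graph $T$ in variables $(x_j)_{j\in J}$ is a graph with edges labeled by the $x_j$; $T(\mathbf a)$ has labels $x_j$ replaced by $a_j$. An algebraic traffic space is a $\mathcal G$-algebra $\mathcal A$ with a linear form $\tau$ on the vector space spanned by graphs with edges labeled in $\mathcal A$ such that: $\tau$ of the graph with no edges is $1$; $\tau[T]$ is unchanged when an edge labeled $Z_h(a_1\otimes\dots\otimes a_K)$ is replaced by $h$ with labels $a_1,\dots,a_K$ (input at the source, output at the target); $\tau$ is linear in the label of each edge. The trace is $\Phi(a)=\tau[\circlearrowleft_a]$ (one loop labeled $a$); thus $\Psi(a)=\tau[\cdot\overset a\leftarrow\cdot]$. The traffic distribution of $\mathbf a$ is $T\mapsto\tau[T(\mathbf a)]$, and convergence in traffic distribution is its pointwise convergence. The injective version $\tau^0$ is defined by $\tau[T]=\sum_{\pi\in\mathcal P(V)}\tau^0[T^\pi]$ for all $T$, with $V$ the vertex set of $T$ and $T^\pi$ the graph with vertices in the same block of $\pi$ identified. $\mathbb J$ denotes a traffic (in some algebraic traffic space) distributed as the limit of the $N\times N$ matrix $\mathbb J_N$ with all entries $1/N$, that is, $\tau[T(\mathbb J)]=\tau^0[T(\mathbb J)]=\mathbf 1(T\text{ is a tree})$ for every test graph $T$ in one variable. Traffic independence. For a test graph $T$ in pairwise disjoint families of variables $\mathbf x_1,\dots,\mathbf x_L$, a colored component is a maximal connected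 subgraph with at least one edge and all labels in one family; $\mathcal{CC}(T)$ is their set. $\mathcal{GCC}(T)$ is the undirected bipartite graph whose vertices are the colored components and the vertices of $T$ belonging to at least two of them, with an edge between a component and such a vertex it contains. Families $\mathbf a_1,\dots,\mathbf a_L$ are traffic independent if $\tau^0[T(\mathbf a_1,\dots,\mathbf a_L)]=\mathbf 1(\mathcal{GCC}(T)\text{ is a tree})\prod_{S\in\mathcal{CC}(T)}\tau^0[S(\mathbf a_1,\dots,\mathbf a_L)]$ for all $T$. ''$a$ is traffic independent from itself'' means this holds for the two one-element families $(a)$ and $(a)$ (test graphs in two variables $x_1,x_2$, both evaluated at $a$). *)

(* Defs.v *)
From mathcomp Require Import all_boot all_algebra.
From mathcomp Require Import boolp.
Set Implicit Arguments.
Unset Strict Implicit.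
Unset Printing Implicit Defensive.
Import GRing.Theory.
Local Open Scope ring_scope.

Record digraph := Digraph {
  vertex : finType;
  edge : finType;
  src : edge -> vertex;
  tgt : edge -> vertex }.

Definition adj (G : digraph) : rel (vertex G) := fun x y =>
  [exists e : edge G, ((src e == x) && (tgt e == y))
                   || ((src e == y) && (tgt e == x))].

Definition linked (G : digraph) : bool :=
  [forall x, forall y, connect (@adj G) x y].

Definition connected (G : digraph) : bool :=
  (0 < #|vertex G|)%N && linked G.

(* A traversal of an edge: [(e, true)] follows the orientation of [e],
   [(e, false)] goes against it. *)
Definition step_from (G : digraph) (p : edge G * bool) : vertex G :=
  if p.2 then src p.1 else tgt p.1.
Definition step_to (G : digraph) (p : edge G * bool) : vertex G :=
  if p.2 then tgt p.1 else src p.1.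

(* Loops are cycles of length one and pairs of parallel (or opposite) edges
   are cycles of length two. *)
Definition graph_cycle (G : digraph) (s : seq (edge G * bool)) : bool :=
  [&& s != [::], cycle (fun p q => step_to p == step_from q) s,
      uniq (map fst s) & uniq (map (@step_from G) s)].

(* Orientations are irrelevant.  The graph without vertices counts as a tree:
   it is the graph of colored components of the test graph without edges, for
   which the defining formula of independence has to read [1 = 1]. *)
Definition tree (G : digraph) : Prop :=
  linked G /\ forall s : seq (edge G * bool), ~~ graph_cycle s.

Record graph := Graph {
  digraph_of :> digraph;
  graphP : connected digraph_of }.

Definition graph_iso (G H : digraph) (f : vertex G -> vertex H)
    (h : edge G -> edge H) : Prop :=
  [/\ bijective f, bijective h, forall e, src (h e) = f (src e)
    & forall e, tgt (h e) = f (tgt e)].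

Lemma adj_sym (G : digraph) : symmetric (@adj G).
Proof.
by move=> x y; apply/existsP/existsP => -[e]; rewrite orbC => He; exists e.
Qed.

Lemma adj_edge (G : digraph) (e : edge G) : adj (src e) (tgt e).
Proof. by apply/existsP; exists e; rewrite !eqxx. Qed.

Lemma connect_adj_sym (G : digraph) : connect_sym (@adj G).
Proof. exact/sym_connect_sym/adj_sym. Qed.

Lemma linkedP (G : digraph) :
  reflect (forall x y, connect (@adj G) x y) (linked G).
Proof.
apply: (iffP forallP) => [h x y|h x]; first exact: (forallP (h x)).
by apply/forallP => y; apply: h.
Qed.

Lemma graph_connect (G : graph) (x y : vertex G) : connect (@adj G) x y.
Proof. by case/andP: (graphP G) => _ /linkedP. Qed.

Lemma graph_gt0 (G : graph) : (0 < #|vertex G|)%N.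
Proof. by case/andP: (graphP G). Qed.

Lemma connect_map (S T : finType) (r : rel S) (r' : rel T) (f : S -> T) :
  (forall x y, r x y -> connect r' (f x) (f y)) ->
  forall x y, connect r x y -> connect r' (f x) (f y).
Proof.
move=> h x y /connectP[p]; elim: p x => [|z p IHp] x /=; first by move=> _ ->.
by case/andP => /h xz /IHp pz /pz; apply: connect_trans.
Qed.

Definition vpart (V : finType) := {P : {set {set V}} | partition P [set: V]}.

Lemma vpart_block (V : finType) (P : vpart V) (x : V) :
  pblock (val P) x \in val P.
Proof. by apply: pblock_mem; rewrite (cover_partition (valP P)) inE. Qed.

Definition block_of (V : finType) (P : vpart V) (x : V) :
  {B : {set V} | B \in val P} := exist _ (pblock (val P) x) (vpart_block P x).

Definition quot_digraph (G : digraph) (P : vpart (vertex G)) : digraph :=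
  @Digraph {B : {set vertex G} | B \in val P} (edge G)
    (fun e => block_of P (src e)) (fun e => block_of P (tgt e)).

Lemma block_of_eq (V : finType) (P : vpart V) (x : V)
  (B : {B : {set V} | B \in val P}) : x \in val B -> block_of P x = B.
Proof.
move=> xB; apply: val_inj => /=.
by case/and3P: (valP P) => _ tI _; rewrite (def_pblock tI (valP B) xB).
Qed.

Lemma block_of_surj (V : finType) (P : vpart V)
  (B : {B : {set V} | B \in val P}) : exists x, block_of P x = B.
Proof.
have := valP B; case/and3P: (valP P) => _ _ n0 BP.
have /set0Pn[x xB]: val B != set0 by apply: contraNneq n0 => <-.
by exists x; apply: block_of_eq.
Qed.

Lemma quot_adj (G : digraph) (P : vpart (vertex G)) (x y : vertex G) :
  adj x y -> @adj (quot_digraph P) (block_of P x) (block_of P y).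
Proof.
by case/existsP => e /orP[] /andP[/eqP<- /eqP<-]; last rewrite adj_sym;
  apply: (@adj_edge (quot_digraph P) e).
Qed.

Lemma quot_connected (G : graph) (P : vpart (vertex G)) :
  connected (quot_digraph P).
Proof.
apply/andP; split.
  case/card_gt0P: (graph_gt0 G) => x _.
  by apply/card_gt0P; exists (block_of P x).
apply/linkedP => B B'.
have [x <-] := block_of_surj B; have [y <-] := block_of_surj B'.
move: (graph_connect x y); apply: connect_map => {}x {}y xy.
exact/connect1/quot_adj.
Qed.

Definition quot (G : graph) (P : vpart (vertex G)) : graph :=
  Graph (quot_connected P).

(* The partition into the classes of the equivalence generated by [r]. *)
Lemma glue_equiv (V : finType) (r : rel V) :
  {in [set: V] & &,
    equivalence_rel (connect (fun x y => r x y || r y x))}.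
Proof.
move=> x y z _ _ _; split=> [|xy]; first exact: connect0.
have sym : connect_sym (fun x y => r x y || r y x).
  by apply: sym_connect_sym => u v; rewrite orbC.
by apply/idP/idP; apply: connect_trans; rewrite // sym.
Qed.

Lemma glue_partP (V : finType) (r : rel V) :
  partition (equivalence_partition
    (connect (fun x y => r x y || r y x)) [set: V]) [set: V].
Proof. exact/equivalence_partitionP/glue_equiv. Qed.

Definition glue_part (V : finType) (r : rel V) : vpart V :=
  exist (fun P => partition P [set: V]) _ (glue_partP r).

Lemma glue_part_eq (V : finType) (r : rel V) (x y : V) :
  r x y -> block_of (glue_part r) x = block_of (glue_part r) y.
Proof.
move=> rxy; apply: block_of_eq => /=.
rewrite (pblock_equivalence_partition (@glue_equiv V r)) ?inE //.
by apply: connect1; rewrite rxy orbT.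
Qed.

Record graph_op := GraphOp {
  op_graph :> graph;
  op_in : vertex op_graph;
  op_out : vertex op_graph }.

Section Subst.
Variables (G : graph) (g : edge G -> graph_op).

Let V : finType := (vertex G + {e : edge G & vertex (g e)})%type.
Let inG (x : vertex G) : V := inl x.
Let inO (e : edge G) (x : vertex (g e)) : V := inr (Tagged (fun e => vertex (g e)) x).

(* The input (resp. output) of [g e] is the source (resp. target) of [e]. *)
Definition subst_rel : rel V := fun x y =>
  [exists e : edge G, ((x == inG (src e)) && (y == inO (op_in (g e))))
                   || ((x == inG (tgt e)) && (y == inO (op_out (g e))))].

Definition subst_pre : digraph :=
  @Digraph V {e : edge G & edge (g e)}
    (fun k => inO (src (tagged k))) (fun k => inO (tgt (tagged k))).

Definition subst_digraph : digraph :=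
  @quot_digraph subst_pre (glue_part subst_rel).

Let q (x : V) : vertex subst_digraph := block_of (glue_part subst_rel) x.

Lemma subst_in e : q (inG (src e)) = q (inO (op_in (g e))).
Proof. by apply: glue_part_eq; apply/existsP; exists e; rewrite !eqxx. Qed.

Lemma subst_out e : q (inG (tgt e)) = q (inO (op_out (g e))).
Proof. by apply: glue_part_eq; apply/existsP; exists e; rewrite !eqxx orbT. Qed.

Lemma subst_connected : connected subst_digraph.
Proof.
have sub e (x y : vertex (g e)) :
    connect (@adj subst_digraph) (q (inO x)) (q (inO y)).
  move: (graph_connect x y).
  apply: (@connect_map _ _ _ _ (fun x => q (inO x))) => {}x {}y xy.
  apply/connect1/(@quot_adj subst_pre).
  case/existsP: xy => k kxy; apply/existsP.
  exists (Tagged (fun e => edge (g e)) k).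
  by case/orP: kxy => /andP[/eqP<- /eqP<-]; rewrite !eqxx ?orbT.
have main x y : connect (@adj subst_digraph) (q (inG x)) (q (inG y)).
  move: (graph_connect x y).
  apply: (@connect_map _ _ _ _ (fun x => q (inG x))) => {}x {}y.
  case/existsP => e /orP[] /andP[/eqP<- /eqP<-];
    last rewrite connect_adj_sym; rewrite subst_in subst_out; exact: sub.
apply/andP; split.
  case/card_gt0P: (graph_gt0 G) => x _.
  by apply/card_gt0P; exists (q (inG x)).
have root B : exists x, connect (@adj subst_digraph) B (q (inG x)).
  have [[x|[e x]] <-] := block_of_surj B; first by exists x; apply: connect0.
  by exists (src e); rewrite subst_in; apply: sub.
apply/linkedP => B B'.
have [x Bx] := root B; have [y By] := root B'.
apply: (connect_trans Bx); apply: (connect_trans (main x y)).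
by rewrite connect_adj_sym.
Qed.

Definition subst : graph := Graph subst_connected.

Definition subst_vertex (x : vertex G) : vertex subst := q (inG x).

End Subst.

Definition op_subst (g : graph_op) (h : edge g -> graph_op) : graph_op :=
  @GraphOp (subst h) (subst_vertex h (op_in g)) (subst_vertex h (op_out g)).

Section Subst1.
Variables (G : graph) (e0 : edge G) (h : graph_op).

Let V : finType := (vertex G + vertex h)%type.

Definition subst1_rel : rel V := fun x y =>
     ((x == inl (src e0)) && (y == inr (op_in h)))
  || ((x == inl (tgt e0)) && (y == inr (op_out h))).

Definition subst1_pre : digraph :=
  @Digraph V ({e : edge G | e != e0} + edge h)%type
    (fun k => match k with inl e => inl (src (val e)) | inr e => inr (src e) end)
    (fun k => match k with inl e => inl (tgt (val e)) | inr e => inr (tgt e) end).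

Definition subst1_digraph : digraph :=
  @quot_digraph subst1_pre (glue_part subst1_rel).

Let q (x : V) : vertex subst1_digraph := block_of (glue_part subst1_rel) x.

Lemma subst1_connected : connected subst1_digraph.
Proof.
have sub (x y : vertex h) :
    connect (@adj subst1_digraph) (q (inr x)) (q (inr y)).
  move: (graph_connect x y).
  apply: (@connect_map _ _ _ _ (fun x => q (inr x))) => {}x {}y xy.
  apply/connect1/(@quot_adj subst1_pre).
  case/existsP: xy => k kxy; apply/existsP; exists (inr k).
  by case/orP: kxy => /andP[/eqP<- /eqP<-]; rewrite !eqxx ?orbT.
have q_in : q (inl (src e0)) = q (inr (op_in h)).
  by apply: glue_part_eq; rewrite /subst1_rel !eqxx.
have q_out : q (inl (tgt e0)) = q (inr (op_out h)).
  by apply: glue_part_eq; rewrite /subst1_rel !eqxx orbT.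
have edgeG e : connect (@adj subst1_digraph) (q (inl (src e))) (q (inl (tgt e))).
  have [->|ne] := eqVneq e e0; first by rewrite q_in q_out; apply: sub.
  apply: connect1.
  exact: (@adj_edge subst1_digraph (inl (exist (fun e => e != e0) e ne))).
have main x y : connect (@adj subst1_digraph) (q (inl x)) (q (inl y)).
  move: (graph_connect x y).
  apply: (@connect_map _ _ _ _ (fun x => q (inl x))) => {}x {}y.
  case/existsP => e /orP[] /andP[/eqP<- /eqP<-];
    last rewrite connect_adj_sym; exact: edgeG.
apply/andP; split.
  by apply/card_gt0P; exists (q (inl (src e0))).
have root B : exists x, connect (@adj subst1_digraph) B (q (inl x)).
  have [[x|x] <-] := block_of_surj B; first by exists x; apply: connect0.
  by exists (src e0); rewrite q_in; apply: sub.
apply/linkedP => B B'.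
have [x Bx] := root B; have [y By] := root B'.
apply: (connect_trans Bx); apply: (connect_trans (main x y)).
by rewrite connect_adj_sym.
Qed.

Definition subst1 : graph := Graph subst1_connected.

End Subst1.

Lemma edge_digraph_connected :
  connected (@Digraph bool unit (fun=> false) (fun=> true)).
Proof.
apply/andP; split; first by rewrite card_bool.
apply/linkedP; set G := (Digraph _ _).
have h : connect (@adj G) false true by apply/connect1/(@adj_edge G tt).
by do 2!case; rewrite ?connect0 // connect_adj_sym.
Qed.

Definition edge_graph : graph := Graph edge_digraph_connected.

Lemma loop_digraph_connected :
  connected (@Digraph unit unit (fun=> tt) (fun=> tt)).
Proof.
by apply/andP; split; rewrite ?card_unit //; apply/linkedP => -[] []; exact: connect0.
Qed.

Definition loop_graph : graph := Graph loop_digraph_connected.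

Lemma point_digraph_connected :
  connected (@Digraph unit void (fun=> tt) (fun=> tt)).
Proof.
by apply/andP; split; rewrite ?card_unit //; apply/linkedP => -[] []; exact: connect0.
Qed.

Definition point_graph : graph := Graph point_digraph_connected.

(* The edge of [edge_graph] goes from [false] to [true]; in [deg_op] the
   vertex [in = out] is its target. *)
Definition edge_op : graph_op := @GraphOp edge_graph false true.
Definition point_op : graph_op := @GraphOp point_graph tt tt.
Definition deg_op : graph_op := @GraphOp edge_graph true true.

(* The arguments of [Z_g] are indexed by the edges of [g] themselves; that
   their numbering is irrelevant is then the invariance [gactI] of [Z] under
   isomorphisms of graph operations. *)
Record galgebra (K : fieldType) := GAlgebra {
  gcarrier :> lmodType K;
  gact : forall g : graph_op, (edge g -> gcarrier) -> gcarrier;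
  gactD : forall (g : graph_op) (a : edge g -> gcarrier) (e : edge g)
      (c : K) (x y : gcarrier),
    gact [eta a with e |-> c *: x + y] =
    c *: gact [eta a with e |-> x] + gact [eta a with e |-> y];
  gactI : forall (g g' : graph_op) (f : vertex g -> vertex g')
      (h : edge g -> edge g') (a : edge g -> gcarrier) (a' : edge g' -> gcarrier),
    graph_iso f h -> f (op_in g) = op_in g' -> f (op_out g) = op_out g' ->
    (forall e, a' (h e) = a e) -> gact a' = gact a;
  gact_edge : forall x : gcarrier, @gact edge_op (fun=> x) = x;
  gact_subst : forall (g : graph_op) (h : edge g -> graph_op)
      (a : forall e : edge g, edge (h e) -> gcarrier),
    gact (fun e => gact (a e)) =
    @gact (op_subst h) (fun k => a (tag k) (tagged k)) }.

Definition gunit (K : fieldType) (A : galgebra K) : A :=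
  @gact K A point_op (@of_void A).

Definition gdeg (K : fieldType) (A : galgebra K) (x : A) : A :=
  @gact K A deg_op (fun=> x).

(* With [X] a G-algebra, these are the graphs with edges labeled in [X]; with
   [X] an index type, the test graphs in variables indexed by [X]. *)
Record lgraph (X : Type) := LGraph {
  lgraph_graph :> graph;
  lab : edge lgraph_graph -> X }.

Definition lgraph_map (X Y : Type) (a : X -> Y) (T : lgraph X) : lgraph Y :=
  @LGraph Y T (fun e => a (lab e)).

Definition lgraph_iso (X : Type) (T T' : lgraph X) : Prop :=
  exists (f : vertex T -> vertex T') (h : edge T -> edge T'),
    graph_iso f h /\ forall e, lab (h e) = lab e.

Definition lquot (X : Type) (T : lgraph X) (P : vpart (vertex T)) : lgraph X :=
  @LGraph X (quot P) (@lab X T).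

Definition lsubst1 (X : Type) (T : lgraph X) (e0 : edge T) (h : graph_op)
    (a : edge h -> X) : lgraph X :=
  @LGraph X (subst1 e0 h)
    (fun k => match k with inl e => lab (val e) | inr e => a e end).

(* A linear form on the space spanned by (isomorphism classes of) labeled
   graphs is determined by its values on the graphs, which are arbitrary. *)
Record traffic_space (K : fieldType) := TrafficSpace {
  talgebra :> galgebra K;
  tau : lgraph talgebra -> K;
  tauI : forall T T' : lgraph talgebra, lgraph_iso T T' -> tau T = tau T';
  tau_noedge : forall T : lgraph talgebra, #|edge T| = 0%N -> tau T = 1;
  tau_subst : forall (G : graph) (l : edge G -> talgebra) (e : edge G)
      (h : graph_op) (a : edge h -> talgebra),
    tau (@LGraph _ G [eta l with e |-> gact a]) =
    tau (@lsubst1 _ (@LGraph _ G l) e h a);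
  tauD : forall (G : graph) (l : edge G -> talgebra) (e : edge G)
      (c : K) (x y : talgebra),
    tau (@LGraph _ G [eta l with e |-> c *: x + y]) =
    c * tau (@LGraph _ G [eta l with e |-> x])
      + tau (@LGraph _ G [eta l with e |-> y]) }.

Section Trace.
Variables (K : fieldType) (A : traffic_space K).

Definition Phi (x : A) : K := tau (@LGraph A loop_graph (fun=> x)).
Definition Psi (x : A) : K := Phi (gdeg x).

Definition discrete_set (V : finType) : {set {set V}} := [set [set x] | x : V].

(* [tau0] is obtained by solving [tau T = \sum_P tau0 (lquot T P)] (lemma
   [tau_sum_tau0] below) recursively on the number of vertices. *)
Fixpoint tau0_rec (n : nat) (T : lgraph A) : K :=
  if n is n'.+1 then
    tau T - \sum_(P : vpart (vertex T) | val P != discrete_set (vertex T))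
              tau0_rec n' (lquot P)
  else 0.

Definition tau0 (T : lgraph A) : K := tau0_rec #|vertex T| T.

Definition vpart_imset (V V' : finType) (f : V -> V') (bf : bijective f)
  (P : vpart V) : vpart V'.
Proof.
exists [set f @: (B : {set V}) | B in val P].
have -> : [set: V'] = f @: [set: V].
  by case: bf => g _ fK; apply/setP=> y; rewrite inE -[y]fK imset_f.
by rewrite imset_partition ?(valP P) //; apply: bij_inj.
Defined.

Lemma vpart_imset_bij (V V' : finType) (f : V -> V') (bf : bijective f) :
  bijective (vpart_imset bf).
Proof.
have [g fK gK] := bf; have bg : bijective g by exists f.
exists (vpart_imset bg) => P; apply: val_inj => /=; rewrite -imset_comp;
  rewrite -[RHS]imset_id; apply: eq_imset => B /=; rewrite -imset_comp;
  by rewrite -[RHS]imset_id; apply: eq_imset => x /=; rewrite ?fK ?gK.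
Qed.

Lemma vpart_imset_discrete (V V' : finType) (f : V -> V') (bf : bijective f)
    (P : vpart V) :
  (val (vpart_imset bf P) == discrete_set V') = (val P == discrete_set V).
Proof.
have -> : discrete_set V' = [set f @: (B : {set V}) | B in discrete_set V].
  have [g fK gK] := bf.
  rewrite /discrete_set -imset_comp.
  apply/setP => B; apply/imsetP/imsetP => -[x _ ->].
    by exists (g x); rewrite //= imset_set1 gK.
  by exists (f x); rewrite //= imset_set1.
exact: (inj_eq (imset_inj (imset_inj (bij_inj bf)))).
Qed.

Lemma lquot_iso (X : Type) (T T' : lgraph X) (f : vertex T -> vertex T')
    (h : edge T -> edge T') (bf : bijective f) (P : vpart (vertex T)) :
  graph_iso f h -> (forall e, lab (h e) = lab e) ->
  lgraph_iso (lquot P) (lquot (vpart_imset bf P)).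
Proof.
case=> _ bh hs ht hl; have injf := bij_inj bf.
have F_mem (B : {B | B \in val P}) :
    f @: val B \in val (vpart_imset bf P).
  by apply/imsetP; exists (val B); rewrite ?(valP B).
pose F (B : {B | B \in val P}) : {B | B \in val (vpart_imset bf P)} :=
  exist (fun B => B \in val (vpart_imset bf P)) _ (F_mem B).
have F_block x : F (block_of P x) = block_of (vpart_imset bf P) (f x).
  apply/esym/block_of_eq; apply: imset_f.
  by rewrite mem_pblock (cover_partition (valP P)) inE.
exists F, h; split=> //; split=> //; last 2 first.
- by move=> e; rewrite /= hs F_block.
- by move=> e; rewrite /= ht F_block.
apply: inj_card_bij.
  by move=> B B' /(congr1 val) /= /(imset_inj injf) /val_inj.
rewrite !card_sig (@eq_card _ _ (mem (val (vpart_imset bf P)))) //=.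
by rewrite card_imset //; apply: imset_inj.
Qed.

Lemma block_of_inj (V : finType) (P : vpart V) :
  injective (block_of P) -> val P = discrete_set V.
Proof.
move=> inj; have blockE x : val (block_of P x) = [set x].
  apply/setP=> y; rewrite inE; apply/idP/eqP => [xy|->].
    by apply: inj; apply: block_of_eq.
  by rewrite mem_pblock (cover_partition (valP P)) inE.
apply/setP => B; apply/idP/imsetP => [PB|[x _ ->]].
  have [x] := block_of_surj (exist (fun B => B \in val P) B PB).
  by move/(congr1 val); rewrite blockE => /= <-; exists x.
by rewrite -blockE; apply: (valP (block_of P x)).
Qed.

Lemma lquot_card (X : Type) (T : lgraph X) (P : vpart (vertex T)) :
  val P != discrete_set (vertex T) -> (#|vertex (lquot P)| < #|vertex T|)%N.
Proof.
apply: contraNltn => le; apply/eqP/block_of_inj.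
have [s sK] := choice (@block_of_surj _ P).
have [|s' _ s'K] := @inj_card_bij _ _ s (can_inj sK); first exact: le.
by move=> x y; rewrite -(s'K x) -(s'K y) !sK => ->.
Qed.

Lemma tau0_recI (n : nat) (T T' : lgraph A) :
  lgraph_iso T T' -> tau0_rec n T = tau0_rec n T'.
Proof.
elim: n T T' => [//|n IHn] T T' TT' /=; rewrite (tauI TT'); congr (_ - _).
have [f [h [gi hl]]] := TT'; have [bf _ _ _] := gi.
rewrite [RHS](reindex (vpart_imset bf)) /=; last exact/onW_bij/vpart_imset_bij.
apply: eq_big => [P|P _]; first by rewrite -(vpart_imset_discrete bf).
by apply: IHn; apply: (lquot_iso bf) gi hl.
Qed.

Lemma tau0_rec_tau0 (n : nat) (T : lgraph A) :
  (#|vertex T| <= n)%N -> tau0_rec n T = tau0 T.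
Proof.
rewrite /tau0; have [m] := ubnP n; elim: m n T => // m IHm [|n] T nm Tn.
  by move: (graph_gt0 T); rewrite ltnNge Tn.
case E: #|vertex T| => [|k]; first by move: (graph_gt0 T); rewrite E.
rewrite /=; congr (_ - _); apply: eq_bigr => P /lquot_card; rewrite E => cP.
have kn : (k <= n)%N by rewrite -ltnS -E.
rewrite (IHm n) //; last exact: leq_trans kn.
by rewrite (IHm k) // (leq_ltn_trans kn).
Qed.

Lemma tau0I (T T' : lgraph A) : lgraph_iso T T' -> tau0 T = tau0 T'.
Proof.
move=> TT'; have [f [h [[bf _ _ _] _]]] := TT'.
by rewrite /tau0 -(bij_eq_card bf); apply: tau0_recI.
Qed.

Lemma discrete_partP (V : finType) : partition (discrete_set V) [set: V].
Proof.
apply/and3P; split.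
- apply/eqP/setP => x; rewrite inE; apply/bigcupP; exists [set x]; last exact: set11.
  by apply/imsetP; exists x.
- apply/trivIsetP => _ _ /imsetP[x _ ->] /imsetP[y _ ->] xy.
  by rewrite disjoints1 inE; apply: contraNneq xy => ->.
- by apply/imsetP => -[x _ /setP/(_ x)]; rewrite !inE eqxx.
Qed.

Definition discrete_part (V : finType) : vpart V :=
  exist (fun P => partition P [set: V]) _ (discrete_partP V).

Lemma lquot_discrete (X : Type) (T : lgraph X) :
  lgraph_iso T (lquot (discrete_part (vertex T))).
Proof.
exists (block_of (discrete_part (vertex T))), id; split=> //; split=> //; last by exists id.
apply: inj_card_bij => [x y xy|].
  have : y \in val (block_of (discrete_part (vertex T)) y).
    by rewrite mem_pblock (cover_partition (valP (discrete_part _))) inE.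
  rewrite -xy; set B := block_of _ x.
  have xB : x \in val B.
    by rewrite mem_pblock (cover_partition (valP (discrete_part _))) inE.
  by case/imsetP: (valP B) xB => z _ ->; rewrite !inE => /eqP-> /eqP->.
by rewrite card_sig (leq_trans _ (leq_imset_card set1 (vertex T))) //.
Qed.

Lemma tau_sum_tau0 (T : lgraph A) :
  tau T = \sum_(P : vpart (vertex T)) tau0 (lquot P).
Proof.
rewrite (bigD1 (discrete_part (vertex T))) //=.
rewrite -(tau0I (lquot_discrete T)) {1}/tau0.
case E: #|vertex T| => [|n]; first by move: (graph_gt0 T); rewrite E.
rewrite /= -[LHS](subrK (\sum_(P : vpart (vertex T) |
  val P != discrete_set (vertex T)) tau0_rec n (lquot P))).
congr (_ + _); apply: eq_bigr => P dP.
apply: tau0_rec_tau0; rewrite -ltnS -E; exact: lquot_card.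
Qed.

End Trace.

Section Components.
Variables (L : nat) (J : 'I_L -> Type) (T : lgraph {l : 'I_L & J l}).

Definition subgraph :=
  {S : {set vertex T} * {set edge T} |
    [forall e in S.2, (src e \in S.1) && (tgt e \in S.1)]}.

Lemma sub_src (S : subgraph) (e : {e | e \in (val S).2}) :
  src (val e) \in (val S).1.
Proof. by have /forall_inP/(_ _ (valP e))/andP[] := valP S. Qed.

Lemma sub_tgt (S : subgraph) (e : {e | e \in (val S).2}) :
  tgt (val e) \in (val S).1.
Proof. by have /forall_inP/(_ _ (valP e))/andP[] := valP S. Qed.

Definition sub_digraph (S : subgraph) : digraph :=
  @Digraph {x | x \in (val S).1} {e | e \in (val S).2}
    (fun e => exist (fun x => x \in (val S).1) _ (sub_src e))
    (fun e => exist (fun x => x \in (val S).1) _ (sub_tgt e)).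

Definition monochromatic (S : subgraph) : bool :=
  [&& connected (sub_digraph S), (val S).2 != set0
    & [exists l : 'I_L, forall e in (val S).2, tag (lab e) == l]].

Definition subgraph_le (S S' : subgraph) : bool :=
  ((val S).1 \subset (val S').1) && ((val S).2 \subset (val S').2).

Definition colored_component (S : subgraph) : bool :=
  monochromatic S &&
  [forall S', monochromatic S' && subgraph_le S S' ==> (S' == S)].

Definition CC := {S : subgraph | colored_component S}.

Lemma CC_connected (S : CC) : connected (sub_digraph (val S)).
Proof. by case: S => S /= /andP[/and3P[]]. Qed.

Definition CC_graph (S : CC) : graph := Graph (CC_connected S).

Definition CC_lgraph (S : CC) : lgraph {l : 'I_L & J l} :=
  @LGraph _ (CC_graph S) (fun e => lab (val e)).

Definition CC_vertex (S : CC) (x : vertex T) : bool := x \in (val (val S)).1.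

Definition shared_vertex := {x : vertex T | (2 <= #|[pred S | CC_vertex S x]|)%N}.

(* The orientation, from components to vertices, plays no role in [tree]. *)
Definition GCC : digraph :=
  @Digraph (CC + shared_vertex)%type
    {p : CC * shared_vertex | CC_vertex p.1 (val p.2)}
    (fun p => inl (val p).1) (fun p => inr (val p).2).

End Components.

Definition traffic_independent (K : fieldType) (A : traffic_space K) (L : nat)
    (J : 'I_L -> Type) (a : forall l : 'I_L, J l -> A) : Prop :=
  let eval := lgraph_map (fun x : {l : 'I_L & J l} => a (tag x) (tagged x)) in
  forall T : lgraph {l : 'I_L & J l},
    tau0 (eval T) =
    `[< tree (GCC T) >]%:R * \prod_(S : CC T) tau0 (eval (CC_lgraph S)).

Definition self_independent (K : fieldType) (A : traffic_space K) (x : A) : Prop :=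
  @traffic_independent K A 2 (fun=> unit) (fun _ _ => x).

(* Independence of the finite initial segments; [a k] stands for the
   [k.+1]-th term. *)
Definition independent_seq (K : fieldType) (A : traffic_space K) (a : nat -> A) : Prop :=
  forall L : nat, @traffic_independent K A L (fun=> unit) (fun l _ => a l).

Definition traffic_dist (K : fieldType) (A : traffic_space K) (J : Type)
    (a : J -> A) (T : lgraph J) : K := tau (lgraph_map a T).

Definition traffic_dist1 (K : fieldType) (A : traffic_space K) (x : A) :
  lgraph unit -> K := traffic_dist (fun=> x).

Definition same_dist (K : fieldType) (A B : traffic_space K) (x : A) (y : B) : Prop :=
  forall T : lgraph unit, traffic_dist1 x T = traffic_dist1 y T.

(* [j] is distributed as the limit of the matrices with all entries [1/N]. *)
Definition is_traffic_J (K : fieldType) (B : traffic_space K) (j : B) : Prop :=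
  forall T : lgraph unit,
    tau (lgraph_map (fun=> j) T) = `[< tree T >]%:R /\
    tau0 (lgraph_map (fun=> j) T) = `[< tree T >]%:R.

(* Main.v *)
Require Import Defs.
From mathcomp Require Import all_boot all_order all_algebra.
From mathcomp Require Import all_classical all_reals all_analysis.
From mathcomp Require Import complex.
From mathcomp Require Import zify.
Set Implicit Arguments.
Unset Strict Implicit.
Unset Printing Implicit Defensive.
Import Order.TTheory GRing.Theory Num.Theory.
Import numFieldNormedType.Exports.
Local Open Scope ring_scope.

(** Write [alpha] for [Phi a] and [beta] for [Psi a - Phi a], and give a connected
    graph the weight [alpha ^+ loops * beta ^+ nonloops] if it becomes a tree when
    its loops are erased, and [0] otherwise ([quasitree_weight]).  Everything
    follows from two facts on this weight.

    It is the injective distribution of [b = alpha I + beta J]: expand [tau] of a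
    graph labeled by [b] over the choices of [I] or [J] on each edge.  In [tau0] an
    edge labeled [I] has to be a loop, and then it may be erased; the remaining
    edges, labeled [J], have to form a tree.  Hence the only choice that contributes
    puts [I] on the loops and [J] elsewhere ([tau_combination]).  Since [tau0] and
    [tau] determine each other by Moebius inversion over the partitions of the
    vertices, having the distribution of [b] means having this weight as injective
    distribution ([same_dist_combination]).

    It satisfies the identity defining traffic independence, for every coloring of
    the edges ([quasitree_weight_CC]): with [chi] the number of vertices minus the
    number of non-loop edges, [chi T - 1] is the sum of [chi GCC - 1] and of the
    [chi S - 1] over the colored components [S], all of these are at most [0], and a
    connected graph is a tree up to loops exactly when its [chi] is [1] ([euler_CC]).

    Consequently an element with the distribution of [b] is independent from itself.
    Conversely, if [a] is independent from itself, coloring one edge differently from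
    all the others splits any graph with at least two edges into components with
    fewer edges, so the identity determines [tau0] from graphs with at most one edge,
    where it is the weight by definition of [Phi] and [Psi] ([self_independentP]).

    For the law of large numbers, [tau] of a graph with [k] edges labeled by the mean
    of [n] copies is the average, over the [n ^ k] colorings of the edges by the
    copies, of the value at the colored graph.  When the coloring is injective the
    components have a single edge, so that value is the one at [b].  The other
    colorings form a proportion [O(1/n)] and their values are bounded, because by
    independence and equality of distribution they are built from finitely many
    numbers: those of the subgraphs of the quotients of the graph ([mean_bound]). *)

(** * Partitions of the vertices and quotients *)

Lemma mem_block_of (V : finType) (P : vpart V) (x : V) : x \in val (block_of P x).
Proof. by rewrite mem_pblock (cover_partition (valP P)) inE. Qed.

Lemma block_of_eqE (V : finType) (P : vpart V) (x y : V) :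
  (block_of P x == block_of P y) = (y \in val (block_of P x)).
Proof.
apply/eqP/idP => [->|yx]; first exact: mem_block_of.
exact/esym/block_of_eq.
Qed.

Lemma vpart_ext (V : finType) (P Q : vpart V) :
  (forall x y, (block_of P x == block_of P y) = (block_of Q x == block_of Q y)) ->
  P = Q.
Proof.
move=> PQ; have same x : val (block_of P x) = val (block_of Q x).
  by apply/setP=> y; rewrite -!block_of_eqE PQ.
apply: val_inj; apply/setP => B; apply/idP/idP => BP.
  have [x /(congr1 val) /= <-] := @block_of_surj V P (exist _ B BP).
  by rewrite [finset.pblock _ _]same; apply: valP.
have [x /(congr1 val) /= <-] := @block_of_surj V Q (exist _ B BP).
by rewrite -[finset.pblock _ _]same; apply: valP.
Qed.

Definition ker_part (V : finType) (W : eqType) (q : V -> W) : vpart V :=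
  exist (fun P => finset.partition P [set: V]) _ (preim_partitionP q [set: V]).

Lemma ker_partE (V : finType) (W : eqType) (q : V -> W) (x y : V) :
  (block_of (ker_part q) x == block_of (ker_part q) y) = (q x == q y).
Proof.
rewrite block_of_eqE /= pblock_equivalence_partition ?inE //.
by split=> // /eqP->.
Qed.

Lemma same_kernel_bij (V W1 W2 : finType) (q1 : V -> W1) (q2 : V -> W2) :
  (forall w, exists x, q1 x = w) -> (forall w, exists x, q2 x = w) ->
  (forall x y, (q1 x == q1 y) = (q2 x == q2 y)) ->
  exists2 f : W1 -> W2, bijective f & forall x, f (q1 x) = q2 x.
Proof.
move=> /choice[s1 s1K] /choice[s2 s2K] q12.
have f1 x : q2 (s1 (q1 x)) = q2 x by apply/eqP; rewrite -q12 s1K.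
exists (fun w => q2 (s1 w)); last exact: f1.
exists (fun w => q1 (s2 w)) => w; last by rewrite f1 s2K.
by apply/eqP; rewrite -[X in _ == X]s1K q12 s2K.
Qed.

(** Substitutions and quotients present their vertices as images of a known set [V].
    To identify two such graphs, it is enough to compare which points of [V] they
    glue and to lift their edges to [V]. *)
Lemma lgraph_iso_kernel (X : Type) (T1 T2 : lgraph X) (V : finType)
    (q1 : V -> vertex T1) (q2 : V -> vertex T2)
    (h : edge T1 -> edge T2) (s t : edge T1 -> V) :
  (forall w, exists x, q1 x = w) -> (forall w, exists x, q2 x = w) ->
  (forall x y, (q1 x == q1 y) = (q2 x == q2 y)) -> bijective h ->
  (forall e, [/\ src e = q1 (s e), tgt e = q1 (t e), src (h e) = q2 (s e),
                 tgt (h e) = q2 (t e) & lab (h e) = lab e]) ->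
  lgraph_iso T1 T2.
Proof.
move=> surj1 surj2 q12 bh hE; have [f bf fq] := same_kernel_bij surj1 surj2 q12.
exists f, h; split; first split=> // e.
- by have [-> _ -> _ _] := hE e; rewrite fq.
- by have [_ -> _ -> _] := hE e; rewrite fq.
by move=> e; case: (hE e).
Qed.

(** Taking preimages under [q] identifies the partitions of its image with the
    partitions of its source that are coarser than the fibers of [q]. *)
Lemma sum_ker_coarser (M : nmodType) (V W : finType) (q : V -> W)
    (F : vpart V -> M) :
  (forall w, exists x, q x = w) ->
  \sum_(P : vpart V | [forall x, forall y, (q x == q y) ==>
                          (block_of P x == block_of P y)]) F P =
  \sum_(Q : vpart W) F (ker_part (fun x => block_of Q (q x))).
Proof.
move=> surj; have [s sK] := choice surj.
rewrite (reindex_onto (fun Q : vpart W => ker_part (fun x => block_of Q (q x)))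
           (fun P => ker_part (fun w => block_of P (s w)))) /=.
  apply: eq_bigl => Q; apply/andP; split.
    apply/forallP => x; apply/forallP => y; apply/implyP => /eqP xy.
    by rewrite ker_partE xy.
  by apply/eqP/vpart_ext => x y; rewrite !ker_partE !sK.
move=> P /forallP cP; apply: vpart_ext => x y; rewrite !ker_partE.
have sq z : block_of P (s (q z)) = block_of P z.
  by have /forallP/(_ z)/implyP := cP (s (q z)); rewrite sK => /(_ (eqxx _))/eqP.
by rewrite !sq.
Qed.

(** Gluing generates an equivalence, so it is enough to check a map on the glued
    pairs to see that it factors through the gluing. *)
Lemma glue_part_sound (V : finType) (W : Type) (r : rel V) (F : V -> W) (x y : V) :
  (forall u v, r u v -> F u = F v) ->
  block_of (glue_part r) x = block_of (glue_part r) y -> F x = F y.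
Proof.
move=> rF /eqP; rewrite block_of_eqE /=.
rewrite (pblock_equivalence_partition (@glue_equiv V r)) ?inE //.
case/connectP => p; elim: p x => [|z p IHp] x /=; first by move=> _ ->.
case/andP => xz pz lz; rewrite -(IHp z pz lz).
by case/orP: xz => /rF.
Qed.

Lemma block_of_discrete_inj (V : finType) : injective (block_of (discrete_part V)).
Proof.
move=> x y xy; have := mem_block_of (discrete_part V) x.
have := mem_block_of (discrete_part V) y; rewrite -xy.
case/imsetP: (valP (block_of (discrete_part V) x)) => z _ ->.
by rewrite !inE => /eqP-> /eqP->.
Qed.

(** * Euler characteristic of connected digraphs *)

Section Spanning.
Variables (G : digraph) (root : vertex G).
Hypothesis linkG : linked G.

Let reach (x : vertex G) (n : nat) : bool :=
  [exists p : n.-tuple (vertex G), path (@adj G) root p && (last root p == x)].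

Lemma reach_ex (x : vertex G) : exists n, reach x n.
Proof.
have /connectP[p rp ->] := linkedP _ linkG root x.
by exists (size p); apply/existsP; exists (in_tuple p); rewrite rp eqxx.
Qed.

Let depth (x : vertex G) : nat := ex_minn (reach_ex x).

(* [x] is the endpoint of [e] that is farther from the root. *)
Let far (e : edge G) (x : vertex G) : bool :=
     ((src e == x) && (depth (tgt e) < depth x)%N)
  || ((tgt e == x) && (depth (src e) < depth x)%N).

Lemma far_inj (e : edge G) (x y : vertex G) : far e x -> far e y -> x = y.
Proof.
by case/orP=> /andP[/eqP<- lx] /orP[] /andP[/eqP<- ly] //;
  rewrite (ltnNge (depth _)) (ltnW lx) in ly.
Qed.

Lemma far_nonloop (e : edge G) (x : vertex G) : far e x -> src e != tgt e.
Proof.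
by case/orP=> /andP[/eqP<- lx]; apply: contraTneq lx => ->; rewrite ltnn.
Qed.

Lemma far_ex (x : {x | x != root}) : exists e, far e (val x).
Proof.
case: x => x /= xr; rewrite /far /depth; case: ex_minnP => n.
case/existsP => -[p /= /eqP szp] /andP[rp /eqP lx] _.
case: (lastP p) => [|p' z] in szp rp lx *; first by rewrite -lx eqxx in xr.
move: rp szp lx; rewrite rcons_path size_rcons last_rcons => /andP[rp' az] szp zx.
rewrite {z}zx in az.
have dy : (depth (last root p') < n)%N.
  rewrite /depth; case: ex_minnP => m _ /(_ (size p')); rewrite -szp ltnS; apply.
  by apply/existsP; exists (in_tuple p'); rewrite rp' eqxx.
case/existsP: az => e /orP[] /andP[/eqP es /eqP et]; exists e; rewrite es et eqxx.
  by rewrite dy orbT.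
by rewrite dy.
Qed.

(** Each vertex other than the root has an edge to a vertex closer to the root, and
    distinct vertices have distinct ones, as [far_inj] shows.  Such a choice is the
    spanning tree behind the Euler inequality. *)
Lemma parent_edge :
  exists2 pe : {x | x != root} -> edge G, injective pe & forall x, far (pe x) (val x).
Proof.
have [pe peP] := choice far_ex; exists pe => // x y xy.
by apply/val_inj/(far_inj (peP x)); rewrite xy.
Qed.

Lemma card_nonroot : #|{: {x | x != root}}|.+1 = #|vertex G|.
Proof. by rewrite card_sig cardC1 prednK //; apply/card_gt0P; exists root. Qed.

(** An edge to a parent is not a loop, which is why only non-loops are counted. *)
Lemma linked_euler : (#|vertex G| <= #|[pred e : edge G | src e != tgt e]|.+1)%N.
Proof.
have [pe pe_inj peP] := parent_edge; rewrite -card_nonroot ltnS -card_sig.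
pose f x : {e : edge G | src e != tgt e} :=
  exist (fun e : edge G => src e != tgt e) _ (far_nonloop (peP x)).
by apply: (@leq_card _ _ f) => x y /(congr1 val) /pe_inj.
Qed.

(* Adjacency in the digraph obtained by deleting [e0]. *)
Let adj_avoiding (e0 : edge G) : rel (vertex G) := fun x y =>
  [exists e : edge G, (e != e0) && (((src e == x) && (tgt e == y))
                                 || ((src e == y) && (tgt e == x)))].

Let next_step : rel (edge G * bool) := fun p q => step_to p == step_from q.

(** Traversals for the steps of a simple path: an edge is used only once, since its
    first use would otherwise leave from a vertex visited again later.  The dummy
    traversal [k0] arriving at [x] gives the induction its first link; it is the edge
    that closes the cycle in [cycle_of_avoiding]. *)
Lemma steps_of_path (e0 : edge G) (p : seq (vertex G)) (x : vertex G) (k0 : edge G * bool) :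
  path (adj_avoiding e0) x p -> uniq (x :: p) -> step_to k0 = x ->
  exists s, [/\ path next_step k0 s, step_to (last k0 s) = last x p,
    map (@step_from G) s = belast x p, uniq (map fst s) &
    forall k, k \in s -> [/\ k.1 != e0, step_from k \in x :: p & step_to k \in x :: p]].
Proof.
elim: p x k0 => [|y p IHp] x k0 /=; first by exists [::].
case/andP => /existsP[e /andP[ne0 exy]] yp /andP[xyp uyp] k0x.
have [b [bx by']] : exists b, step_from (e, b) = x /\ step_to (e, b) = y.
  case/orP: exy => /andP[/eqP es /eqP et]; first by exists true.
  by exists false.
have [s [ps ls ms us Ps]] := IHp y (e, b) yp uyp by'.
exists ((e, b) :: s); split=> //=.
- by rewrite ps andbT /next_step k0x bx.
- by rewrite ms bx.
- rewrite us andbT; apply/mapP => -[[e' b'] ks /= ee']; subst e'.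
  have [_ kf kt] := Ps _ ks.
  have : (x == step_from (e, b')) || (x == step_to (e, b')).
    by rewrite -bx; case: (b); case: (b'); rewrite /step_from /step_to /= eqxx ?orbT.
  by case/orP=> /eqP xk; rewrite xk ?kf ?kt in xyp.
- move=> k; rewrite inE => /orP[/eqP->|/Ps[k1 k2 k3]].
    by rewrite bx by' !inE !eqxx orbT.
  by rewrite !(inE, orbC (_ == x)) -!in_cons k2 k3.
Qed.

Lemma cycle_of_avoiding (e0 : edge G) :
  connect (adj_avoiding e0) (tgt e0) (src e0) -> exists s, @graph_cycle G s.
Proof.
case/connectP => p' /shortenP[p xp up _] lp.
have [s [ps ls ms us Ps]] := @steps_of_path e0 p (tgt e0) (e0, true) xp up erefl.
exists ((e0, true) :: s); rewrite /graph_cycle /= us ms andbT rcons_path ps /=.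
rewrite ls -lp eqxx /=; apply/and3P; split.
- by apply/mapP => -[k /Ps[/eqP k0 _ _] ek]; rewrite -ek in k0.
all: by move: up; rewrite lastI rcons_uniq -lp => /andP[].
Qed.

Lemma tree_euler_root : tree G <-> #|vertex G| = #|edge G|.+1.
Proof.
have [pe pe_inj peP] := parent_edge.
split=> [[_ acyc]|cardE].
  rewrite -card_nonroot; congr _.+1; apply/eqP; rewrite eqn_leq (leq_card pe pe_inj) /=.
  rewrite leqNgt; apply/negP => lt.
  (* An edge that is no vertex's parent edge closes a cycle. *)
  have [e0 e0P] : exists e0, e0 \notin codom pe.
    apply/existsP; rewrite -negb_forall; apply: contraL lt => /forallP all.
    by rewrite -leqNgt -(card_codom pe_inj); apply/eq_leq/eq_card => e; rewrite all.
  have avoid_sym : symmetric (adj_avoiding e0).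
    by move=> x y; apply: eq_existsb => e; rewrite orbC.
  have to_root x : connect (adj_avoiding e0) x root.
    have [n] := ubnP (depth x); elim: n x => // n IHn x dx.
    have [->|xr] := eqVneq x root; first exact: connect0.
    have := peP (exist _ x xr); set e := pe _ => /= fe.
    have ne : e != e0 by apply: contraNneq e0P => <-; apply: codom_f.
    case/orP: fe => /andP[/eqP ex lt']; [apply: connect_trans (IHn (tgt e) _)
      | apply: connect_trans (IHn (src e) _)]; try exact: leq_trans lt' _;
      by apply: connect1; apply/existsP; exists e; rewrite ne ex !eqxx ?orbT.
  have [|s] := @cycle_of_avoiding e0; last by rewrite (negPf (acyc s)).
  apply: connect_trans (to_root _) _.
  by rewrite (sym_connect_sym avoid_sym); apply: to_root.
split=> // s; apply/negP => /and4P[sn0 cs ue uv].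
have pe_surj e : exists x, pe x = e.
  have [|g _ gK] := @inj_card_bij _ _ pe pe_inj.
    by rewrite -ltnS -cardE card_nonroot.
  by exists (g e).
have [k0 k0s] : exists k0, k0 \in s.
  by case: (s) sn0 => // k s' _; exists k; rewrite mem_head.
(* At a vertex of the cycle farthest from the root, both edges of the cycle have to
   be its parent edge.  They coincide only in a loop, which is no parent edge. *)
have [k ks kmax] := @arg_maxnP _ k0 (mem s) (fun k => depth (step_from k)) k0s.
have far_step (k' : edge G * bool) (x : vertex G) :
    (step_from k' = x /\ depth (step_to k') <= depth x)%N
    \/ (step_to k' = x /\ depth (step_from k') <= depth x)%N -> far k'.1 x.
  have [x' ex'] := pe_surj k'.1; have := peP x'; rewrite ex'; move: (val x') => y {x' ex'}.
  case: k' => e b; rewrite /step_from /step_to /far /=.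
  case: b => /= /orP[] /andP[/eqP <- lt] [] [<- le]; rewrite ?eqxx ?lt ?orbT //;
    by rewrite leqNgt lt in le.
have farP x e e' : far e x -> far e' x -> e = e'.
  have [y <-] := pe_surj e; have [y' <-] := pe_surj e' => f1 f2; congr pe.
  by apply: val_inj; rewrite (far_inj (peP y) f1) (far_inj (peP y') f2).
have k's : prev s k \in s by rewrite mem_prev.
have ks'' : next s k \in s by rewrite mem_next.
have /eqP k'k := prev_cycle cs ks.
have /eqP kk'' := next_cycle cs ks.
have fk : far k.1 (step_from k) by apply: far_step; left; split; rewrite // kk''; apply: kmax.
have fk' : far (prev s k).1 (step_from k).
  by apply: far_step; right; split; last exact: kmax.
have kE : prev s k = k.
  move: (farP _ _ _ fk' fk) => ee; rewrite -(nth_index k k's) -[RHS](nth_index k ks).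
  congr nth; apply/eqP.
  have lt := etrans (index_mem _ _) k's; have lt' := etrans (index_mem _ _) ks.
  rewrite -(nth_uniq (fst k) _ _ ue) ?size_map // !(nth_map k) //.
  by rewrite !nth_index // ee.
have := far_nonloop fk; rewrite kE in k'k.
by case: (k) k'k => e []; rewrite /step_from /step_to /= => ->; rewrite eqxx.
Qed.

End Spanning.

(** The parent edges form a spanning tree with one edge less than there are vertices;
    without further edges there is no cycle, and any further edge closes one. *)
Lemma tree_euler (G : digraph) : linked G -> (0 < #|vertex G|)%N ->
  tree G <-> #|vertex G| = #|edge G|.+1.
Proof. by move=> lG /card_gt0P[r _]; apply: tree_euler_root lG. Qed.

(** * Colored components *)

Lemma card_sum_bool (I : finType) (P : pred I) : #|P| = (\sum_i P i)%N.
Proof.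
rewrite -sum1_card big_mkcond; apply: eq_bigr => i _.
by rewrite unfold_in; case: (P i).
Qed.

Lemma card_sub_pred (I : finType) (A P : pred I) :
  #|[pred x : {x | A x} | P (val x)]| = #|[pred x | A x && P x]|.
Proof.
rewrite !card_sum_bool -(big_sub A (fun x => (P x : nat))) big_mkcond.
by apply: eq_bigr => x _; rewrite unfold_in /=; case: (A x).
Qed.

Section Components.
Variables (L : nat) (J : 'I_L -> Type) (T : lgraph {l : 'I_L & J l}).
Implicit Types (S U : subgraph T) (e : edge T) (C : CC T).

Lemma sub_connect_le S U (leSU : subgraph_le S U)
    (x y : vertex (sub_digraph S)) (x' y' : vertex (sub_digraph U)) :
  val x = val x' -> val y = val y' ->
  connect (@adj (sub_digraph S)) x y -> connect (@adj (sub_digraph U)) x' y'.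
Proof.
have /andP[/fintype.subsetP leV /fintype.subsetP leE] := leSU.
pose f (z : vertex (sub_digraph S)) : vertex (sub_digraph U) :=
  exist (fun z => z \in (val U).1) (val z) (leV _ (valP z)).
move=> xx yy; have -> : x' = f x by apply: val_inj.
have -> : y' = f y by apply: val_inj.
apply: connect_map => {x y xx yy} x y /existsP[e exy]; apply: connect1.
pose e' : edge (sub_digraph U) :=
  exist (fun e => e \in (val U).2) (val e) (leE _ (valP e)).
have fs : f (src e) = src e' by apply: val_inj.
have ft : f (tgt e) = tgt e' by apply: val_inj.
by case/orP: exy => /andP[/eqP<- /eqP<-]; last rewrite adj_sym;
  rewrite fs ft adj_edge.
Qed.

Lemma monochromatic_color S :
  monochromatic S -> exists l : 'I_L, forall e, e \in (val S).2 -> tag (lab e) = l.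
Proof.
case/and3P=> _ _ /existsP[l /forallP lP]; exists l => e eS.
by have /implyP/(_ eS)/eqP := lP e.
Qed.

(** Two connected subgraphs of the same color that share an edge have a connected
    union of the same color, so maximal ones that share an edge are equal. *)
Lemma monochromatic_union S U e :
  monochromatic S -> monochromatic U -> e \in (val S).2 -> e \in (val U).2 ->
  exists2 W, monochromatic W & subgraph_le S W /\ subgraph_le U W.
Proof.
move=> mS mU eS eU.
have WP : [forall e in (val S).2 :|: (val U).2,
    (src e \in (val S).1 :|: (val U).1) && (tgt e \in (val S).1 :|: (val U).1)].
  apply/forall_inP => k; rewrite !inE => /orP[] kE.
    by have /forall_inP/(_ _ kE)/andP[-> ->] := valP S.
  by have /forall_inP/(_ _ kE)/andP[-> ->] := valP U; rewrite !orbT.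
pose W : subgraph T := exist (fun W : {set vertex T} * {set edge T} =>
  is_true [forall e in W.2, (src e \in W.1) && (tgt e \in W.1)])
  ((val S).1 :|: (val U).1, (val S).2 :|: (val U).2) WP.
have leS : subgraph_le S W by rewrite /subgraph_le !finset.subsetUl.
have leU : subgraph_le U W by rewrite /subgraph_le !finset.subsetUr.
exists W => //; apply/and3P; split.
- have srcS : src e \in (val S).1 by have /forall_inP/(_ _ eS)/andP[] := valP S.
  have srcU : src e \in (val U).1 by have /forall_inP/(_ _ eU)/andP[] := valP U.
  have srcW : src e \in (val W).1 by rewrite inE srcS.
  pose c : vertex (sub_digraph W) := exist (fun z => z \in (val W).1) _ srcW.
  apply/andP; split; first by apply/card_gt0P; exists c.
  have toc (x : vertex (sub_digraph W)) : connect (@adj (sub_digraph W)) x c.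
    have := valP x; rewrite inE => /orP[] xI.
      have /and3P[/andP[_ /linkedP cS] _ _] := mS.
      exact: (sub_connect_le leS (x := exist (fun z => z \in (val S).1) _ xI)
          (y := exist (fun z => z \in (val S).1) _ srcS)).
    have /and3P[/andP[_ /linkedP cU] _ _] := mU.
    exact: (sub_connect_le leU (x := exist (fun z => z \in (val U).1) _ xI)
        (y := exist (fun z => z \in (val U).1) _ srcU)).
  apply/linkedP => x y; apply: connect_trans (toc x) _.
  by rewrite connect_adj_sym.
- by apply/set0Pn; exists e; rewrite inE eS.
- have [l lP] := monochromatic_color mS; have [l' lP'] := monochromatic_color mU.
  have ll : l = l' by rewrite -(lP _ eS) (lP' _ eU).
  apply/existsP; exists l; apply/forall_inP => k; rewrite inE => /orP[/lP|/lP'] ->//.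
  by rewrite ll.
Qed.

Lemma CC_edge_uniq C C' e : e \in (val (val C)).2 -> e \in (val (val C')).2 -> C = C'.
Proof.
move=> eC eC'; have /andP[mC /forallP maxC] := valP C.
have /andP[mC' /forallP maxC'] := valP C'.
have [W mW [leW leW']] := monochromatic_union mC mC' eC eC'.
have := maxC W; rewrite mW leW /= => /eqP WC.
have := maxC' W; rewrite mW leW' /= => /eqP WC'.
by apply: val_inj; apply: etrans (esym WC) WC'.
Qed.

Lemma monochromatic_edge e : exists2 S, monochromatic S & e \in (val S).2.
Proof.
have SP : [forall k in [set e], (src k \in [set src e; tgt e])
                             && (tgt k \in [set src e; tgt e])].
  by apply/forall_inP => k; rewrite !inE => /eqP->; rewrite !eqxx orbT.
pose S : subgraph T := exist (fun W : {set vertex T} * {set edge T} =>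
  is_true [forall e in W.2, (src e \in W.1) && (tgt e \in W.1)])
  ([set src e; tgt e], [set e]) SP.
have eS : e \in (val S).2 by rewrite inE.
exists S => //; apply/and3P; split.
- pose k : edge (sub_digraph S) := exist (fun k => k \in (val S).2) e eS.
  apply/andP; split; first by apply/card_gt0P; exists (src k).
  have tok (x : vertex (sub_digraph S)) : connect (@adj (sub_digraph S)) x (src k).
    have := valP x; rewrite !inE => /orP[] /eqP xE.
      by have -> : x = src k by apply: val_inj.
    have -> : x = tgt k by apply: val_inj.
    by rewrite connect_adj_sym; apply/connect1/adj_edge.
  apply/linkedP => x y; apply: connect_trans (tok x) _.
  by rewrite connect_adj_sym.
- by apply/set0Pn; exists e.
- apply/existsP; exists (tag (lab e)); apply/forall_inP => k.
  by rewrite inE => /eqP->.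
Qed.

(** A largest connected one-colored subgraph containing [e] is maximal. *)
Lemma CC_edge e : exists C, e \in (val (val C)).2.
Proof.
have [S0 mS0 eS0] := monochromatic_edge e.
pose P := [pred S | monochromatic S && (e \in (val S).2)].
have PS0 : P S0 by rewrite /= mS0.
have [S /andP[mS eS] Smax] :=
  @arg_maxnP _ S0 P (fun S => #|(val S).1| + #|(val S).2|)%N PS0.
suff cS : colored_component S by exists (exist (fun S => colored_component S) S cS).
apply/andP; split=> //; apply/forallP => U; apply/implyP => /andP[mU /andP[leV leE]].
have := Smax U; rewrite /= mU (fintype.subsetP leE _ eS) => /(_ isT) le.
have cV := subset_leq_card leV; have cE := subset_leq_card leE.
have eqV : (val S).1 = (val U).1.
  apply/eqP; rewrite eqEcard leV /=.
  by rewrite -(leq_add2r #|(val S).2|) (leq_trans _ le) // leq_add2l.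
have eqE : (val S).2 = (val U).2.
  apply/eqP; rewrite eqEcard leE /=.
  by rewrite -(leq_add2l #|(val S).1|) (leq_trans _ le) // leq_add2r.
by apply/eqP/val_inj; rewrite [LHS]surjective_pairing -eqV -eqE -surjective_pairing.
Qed.

Lemma CC_src C e : e \in (val (val C)).2 -> CC_vertex C (src e).
Proof. by move=> eC; have /forall_inP/(_ _ eC)/andP[] := valP (val C). Qed.

Lemma CC_tgt C e : e \in (val (val C)).2 -> CC_vertex C (tgt e).
Proof. by move=> eC; have /forall_inP/(_ _ eC)/andP[] := valP (val C). Qed.

Lemma CC_nonempty C : exists e, e \in (val (val C)).2.
Proof. by have /andP[/and3P[_ /set0Pn]] := valP C. Qed.

Hypothesis edges : (0 < #|edge T|)%N.

Lemma CC_cover (x : vertex T) : exists C, CC_vertex C x.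
Proof.
have [e _] := card_gt0P edges.
have /connectP[[|y p] /=] := graph_connect x (src e).
  by move=> _ <-; have [C eC] := CC_edge e; exists C; apply: CC_src.
move=> /andP[/existsP[k kxy] _] _; have [C kC] := CC_edge k.
exists C; case/orP: kxy => /andP[].
  by move=> /eqP<- _; apply: CC_src.
by move=> _ /eqP<-; apply: CC_tgt.
Qed.

Let comp (C : CC T) : vertex (GCC T) := inl C.
Let shared (x : shared_vertex T) : vertex (GCC T) := inr x.

Lemma GCC_adj C (x : shared_vertex T) :
  CC_vertex C (val x) -> @adj (GCC T) (comp C) (shared x).
Proof.
move=> Cx.
exact: (@adj_edge (GCC T)
  (exist (fun p : CC T * shared_vertex T => CC_vertex p.1 (val p.2)) (C, x) Cx)).
Qed.

Lemma shared_ex (x : vertex T) C C' : CC_vertex C x -> CC_vertex C' x -> C != C' ->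
  exists y : shared_vertex T, val y = x.
Proof.
move=> Cx C'x CC'; have xP : (2 <= #|[pred S : CC T | CC_vertex S x]|)%N.
  by apply/card_gt1P; exists C, C'; split; rewrite ?inE.
by exists (Sub x xP); rewrite SubK.
Qed.

Lemma GCC_connect_at (x : vertex T) C C' :
  CC_vertex C x -> CC_vertex C' x -> connect (@adj (GCC T)) (comp C) (comp C').
Proof.
move=> Cx C'x; have [->|CC'] := eqVneq C C'; first exact: connect0.
have [y yx] := shared_ex Cx C'x CC'.
apply: (@connect_trans _ _ (shared y)); first by apply/connect1/GCC_adj; rewrite yx.
by rewrite connect_adj_sym; apply/connect1/GCC_adj; rewrite yx.
Qed.

(** A path of [T] is followed in [GCC T] through the components of its edges:
    consecutive edges lie in the same component or in two components that share the
    vertex between them. *)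
Lemma GCC_linked : linked (GCC T).
Proof.
have main (x y : vertex T) : connect (@adj T) x y -> forall C C',
    CC_vertex C x -> CC_vertex C' y -> connect (@adj (GCC T)) (comp C) (comp C').
  case/connectP => p; elim: p x => [|z p IHp] x /=.
    by move=> _ -> C C'; apply: GCC_connect_at.
  case/andP => /existsP[k kxz] pz yp C C' Cx C'y; have [D kD] := CC_edge k.
  have [Dx Dz] : CC_vertex D x /\ CC_vertex D z.
    by case/orP: kxz => /andP[/eqP<- /eqP<-]; split; rewrite ?CC_src ?CC_tgt.
  exact: connect_trans (GCC_connect_at Cx Dx) (IHp _ pz yp _ _ Dz C'y).
have mainC C C' : connect (@adj (GCC T)) (comp C) (comp C').
  have [e eC] := CC_nonempty C; have [e' eC'] := CC_nonempty C'.
  exact: main (graph_connect _ _) _ _ (CC_src eC) (CC_src eC').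
have toC (z : vertex (GCC T)) : exists C, connect (@adj (GCC T)) z (comp C).
  case: z => [C|x]; first by exists C; apply: connect0.
  have [C Cx] := CC_cover (val x); exists C.
  by rewrite connect_adj_sym; apply/connect1/GCC_adj.
apply/linkedP => z z'; have [C zC] := toC z; have [C' zC'] := toC z'.
apply: connect_trans zC _; apply: connect_trans (mainC C C') _.
by rewrite connect_adj_sym.
Qed.

Lemma GCC_gt0 : (0 < #|vertex (GCC T)|)%N.
Proof.
have [e _] := card_gt0P edges; have [C _] := CC_edge e.
by apply/card_gt0P; exists (comp C).
Qed.

End Components.

Section Counting.
Variables (L : nat) (J : 'I_L -> Type) (T : lgraph {l : 'I_L & J l}).

Lemma card_edges_CC (P : pred (edge T)) :
  (\sum_(C : CC T) #|[pred e : edge (CC_graph C) | P (val e)]|)%N = #|P|.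
Proof.
transitivity (\sum_(C : CC T) \sum_e ((e \in (val (val C)).2) && P e : nat))%N.
  apply: eq_bigr => C _.
  by rewrite (card_sub_pred (fun e => e \in (val (val C)).2) P) card_sum_bool.
rewrite exchange_big card_sum_bool; apply: eq_bigr => e _ /=.
have [C eC] := CC_edge e; rewrite (bigD1 C) //= eC big1 ?addn0 // => C' C'C.
by case eC': (e \in _) => //=; rewrite (CC_edge_uniq eC' eC) eqxx in C'C.
Qed.

Let mult (x : vertex T) : nat := #|[pred C : CC T | CC_vertex C x]|.

Lemma card_vertices_CC : (\sum_(C : CC T) #|vertex (CC_graph C)|)%N = (\sum_x mult x)%N.
Proof.
transitivity (\sum_(C : CC T) \sum_x (CC_vertex C x : nat))%N.
  apply: eq_bigr => C _; rewrite card_sig card_sum_bool.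
  by apply: eq_bigr.
by rewrite exchange_big; apply: eq_bigr => x _; rewrite [RHS]card_sum_bool.
Qed.

Lemma card_GCC_edges :
  #|edge (GCC T)| = (\sum_(x : vertex T | 2 <= mult x) mult x)%N.
Proof.
rewrite card_sig card_sum_bool.
rewrite -(pair_bigA _ (fun (C : CC T) (x : shared_vertex T) => (CC_vertex C (val x) : nat))).
rewrite exchange_big /=; transitivity (\sum_(x : shared_vertex T) mult (val x))%N.
  by apply: eq_bigr => x _; rewrite [RHS]card_sum_bool.
exact/esym/(big_sub (fun x => 2 <= mult x)%N mult).
Qed.

(** Double counting of the pairs of a component and a vertex of it: a vertex that is
    not shared lies in exactly one component. *)
Lemma card_GCC (edges : (0 < #|edge T|)%N) :
  (#|vertex T| + #|edge (GCC T)| + #|{: CC T}| =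
   \sum_(C : CC T) #|vertex (CC_graph C)| + #|vertex (GCC T)|)%N.
Proof.
pose big x := (2 <= mult x)%N.
have cV : #|vertex T| = (#|[pred x | big x]| + #|[pred x | ~~ big x]|)%N.
  by rewrite -(cardC [pred x | big x]); congr (_ + _)%N; apply: eq_card.
have sM : (\sum_x mult x =
    \sum_(x : vertex T | big x) mult x + #|[pred x | ~~ big x]|)%N.
  rewrite (bigID big) /=; congr (_ + _)%N; rewrite -sum1_card; apply: eq_bigr => x.
  rewrite /big -ltnNge ltnS => mx; apply/eqP; rewrite eqn_leq mx.
  by have [C Cx] := CC_cover edges x; apply/card_gt0P; exists C.
have cS : #|{: shared_vertex T}| = #|[pred x | big x]| by rewrite card_sig.
rewrite card_GCC_edges card_vertices_CC /= card_sum sM cV cS.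
have nat_id (a b s c : nat) : (a + b + s + c = s + b + (c + a))%N by lia.
exact: nat_id.
Qed.

(** With [chi] the number of vertices minus the number of non-loop edges, [card_GCC]
    reads [chi T - 1 = (chi GCC - 1) + \sum_C (chi C - 1)].  All the terms are
    nonpositive by [linked_euler], so the left-hand side vanishes exactly when all of
    them do. *)
Lemma euler_CC (edges : (0 < #|edge T|)%N) :
  (#|vertex T| == #|[pred e : edge T | src e != tgt e]|.+1) =
  `[< tree (GCC T) >] && [forall C : CC T,
     #|vertex (CC_graph C)| == #|[pred e : edge (CC_graph C) | src e != tgt e]|.+1].
Proof.
set nl := fun G : digraph => #|[pred e : edge G | src e != tgt e]|.
have nlE : nl T = (\sum_(C : CC T) nl (CC_graph C))%N.
  rewrite -[nl T](card_edges_CC (fun e => src e != tgt e)).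
  by apply: eq_bigr => C _; apply: eq_card => e; rewrite !inE.
have le (C : CC T) : (#|vertex (CC_graph C)| <= (nl (CC_graph C)).+1)%N.
  have /card_gt0P[r _] := graph_gt0 (CC_graph C).
  by apply: linked_euler r _; have /andP[] := graphP (CC_graph C).
have leG : (#|vertex (GCC T)| <= #|edge (GCC T)|.+1)%N.
  have /card_gt0P[r _] := GCC_gt0 edges.
  rewrite (leq_trans (linked_euler r (GCC_linked edges))) // ltnS max_card.
have treeE := tree_euler (GCC_linked edges) (GCC_gt0 edges).
have cG := card_GCC edges.
pose D := (\sum_(C : CC T) ((nl (CC_graph C)).+1 - #|vertex (CC_graph C)|))%N.
have DE : (D + \sum_(C : CC T) #|vertex (CC_graph C)| = nl T + #|{: CC T}|)%N.
  rewrite -big_split nlE -sum1_card -big_split /=; apply: eq_bigr => C _.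
  by rewrite subnK ?le // addn1.
have -> : [forall C : CC T, #|vertex (CC_graph C)| == (nl (CC_graph C)).+1] = (D == 0%N).
  rewrite sum_nat_eq0; apply: eq_forallb => C /=.
  by rewrite subn_eq0 eqn_leq le.
have -> : `[< tree (GCC T) >] = (#|vertex (GCC T)| == #|edge (GCC T)|.+1).
  by apply/asboolP/eqP => /treeE.
rewrite -/(nl T); lia.
Qed.

End Counting.

(** * Multilinear expansion *)

Section Multilinear.
Variables (K : fieldType) (V : lmodType K) (E : finType) (F : (E -> V) -> K).
Hypothesis F_linear : forall l e (c : K) x y,
  F [eta l with e |-> c *: x + y] = c * F [eta l with e |-> x] + F [eta l with e |-> y].

Lemma multilinear_sum1 (I : finType) (w : I -> K) (x : I -> V) l e :
  F [eta l with e |-> \sum_i w i *: x i] = \sum_i w i * F [eta l with e |-> x i].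
Proof.
elim/big_rec2: _ => [|i u v _ <-]; last exact: F_linear.
have := F_linear l e 1 0 0; rewrite scaler0 addr0 mul1r => h.
by apply: (addIr (F [eta l with e |-> 0])); rewrite -h add0r.
Qed.

(** The expansion is proved for the edges of a duplicate-free list [s]; the colorings
    are those with the default value [i0] outside [s], so that each of them is counted
    once. *)
Lemma multilinear_sum (I : finType) (i0 : I) (w : I -> K) (x : I -> V) :
  F (fun=> \sum_i w i *: x i) =
  \sum_(c : {ffun E -> I}) (\prod_e w (c e)) * F (fun e => x (c e)).
Proof.
pose P (s : seq E) (c : {ffun E -> I}) := [forall e, (e \notin s) ==> (c e == i0)].
have main (s : seq E) (y : E -> V) : uniq s ->
    F (fun e => if e \in s then \sum_i w i *: x i else y e) =
    \sum_(c | P s c) (\prod_(e <- s) w (c e)) * F (fun e => if e \in s then x (c e) else y e).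
  elim: s y => [|e0 s IHs] y /=.
    move=> _; rewrite (big_pred1 [ffun=> i0]) ?big_nil ?mul1r // => c.
    apply/forallP/eqP => [c0|-> e]; last by rewrite ffunE eqxx implybT.
    by apply/ffunP => e; rewrite ffunE; apply/eqP/(c0 e).
  case/andP => e0s us; set Sum := \sum_i w i *: x i.
  transitivity (\sum_i w i * F (fun e => if e \in s then Sum else [eta y with e0 |-> x i] e)).
    transitivity (F [eta (fun e => if e \in s then Sum else y e) with e0 |-> Sum]).
      by congr F; apply: funext => e /=; rewrite inE; case: eqP.
    rewrite multilinear_sum1; apply: eq_bigr => i _; congr (_ * F _).
    by apply: funext => e /=; case: eqP => // ->; rewrite (negPf e0s).
  rewrite (eq_bigr _ (fun i _ => congr1 ( *%R (w i)) (IHs _ us))).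
  under eq_bigr => i _ do rewrite big_distrr /=.
  pose upd (c : {ffun E -> I}) (i : I) := [ffun e => if e == e0 then i else c e].
  rewrite pair_big_dep /= (reindex_onto (fun c : {ffun E -> I} => (c e0, upd c i0))
      (fun p => upd p.2 p.1)) /=; last first.
    move=> [i c] /= /forallP cP; rewrite ffunE eqxx; congr (_, _).
    apply/ffunP => e; rewrite !ffunE; case: eqP => // ->.
    by have := cP e0; rewrite e0s => /eqP.
  have updE c i e : e \in s -> upd c i e = c e.
    by move=> es; rewrite ffunE; case: eqP => // ee; rewrite -ee es in e0s.
  apply: eq_big => c.
    have -> : upd (upd c i0) (c e0) == c.
      by apply/eqP/ffunP => e; rewrite !ffunE; case: eqP => // ->.
    rewrite andbT; apply: eq_forallb => e; rewrite inE negb_or ffunE.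
    by case: (e == e0); rewrite ?eqxx ?implybT.
  move=> _; rewrite mulrA big_cons; congr (_ * _ * F _).
    by apply: eq_big_seq => e es; rewrite updE.
  apply: funext => e /=; rewrite inE; case: eqP => [->|_]; first by rewrite (negPf e0s).
  by case: ifP => // es; rewrite updE.
have -> : F (fun=> \sum_i w i *: x i) =
    F (fun e => if e \in enum E then \sum_i w i *: x i else 0).
  by congr F; apply: funext => e; rewrite mem_enum.
rewrite main ?enum_uniq //; apply: eq_big => c.
  by apply/forallP => e; rewrite mem_enum.
move=> _; rewrite big_enum; congr (_ * F _).
by apply: funext => e; rewrite mem_enum.
Qed.

End Multilinear.

(** * Weight of trees with loops *)

Section Weight.
Variables (K : fieldType) (alpha beta : K).

Definition nonloops (G : digraph) : pred (edge G) := fun e => src e != tgt e.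
Definition loops (G : digraph) : pred (edge G) := fun e => src e == tgt e.

(** A connected graph has one more vertex than non-loop edges exactly when erasing
    its loops leaves a tree. *)
Definition quasitree_weight (G : digraph) : K :=
  (#|vertex G| == #|@nonloops G|.+1)%:R * (alpha ^+ #|@loops G| * beta ^+ #|@nonloops G|).

Lemma quasitree_weight_iso (G H : digraph) f h :
  @graph_iso G H f h -> quasitree_weight G = quasitree_weight H.
Proof.
case=> bf [g hK gK] hs ht; have fE := inj_eq (bij_inj bf).
have cE (P : pred (edge G)) (Q : pred (edge H)) : (forall e, Q (h e) = P e) -> #|P| = #|Q|.
  move=> PQ; rewrite -(fintype.card_image (can_inj hK)); apply: eq_card => e.
  apply/fintype.imageP/idP.
    by case=> e' Pe' ->; rewrite unfold_in PQ.
  by move=> Qe; exists (g e); rewrite ?gK // unfold_in -PQ gK.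
rewrite /quasitree_weight (bij_eq_card bf).
rewrite (cE (@nonloops G) (@nonloops H)) ?(cE (@loops G) (@loops H)) // => e;
  by rewrite /loops /nonloops hs ht fE.
Qed.

Lemma edgeless_vertices (G : graph) : #|edge G| = 0%N -> #|vertex G| = 1%N.
Proof.
move=> E0; have /andP[V0 lG] := graphP G; have [r _] := card_gt0P V0.
apply/eqP; rewrite eqn_leq V0 andbT (leq_trans (linked_euler r lG)) //.
by rewrite ltnS -E0 max_card.
Qed.

Lemma quasitree_weight_edgeless (G : graph) : #|edge G| = 0%N -> quasitree_weight G = 1.
Proof.
move=> E0; have P0 (P : pred (edge G)) : #|P| = 0%N.
  by apply/eqP; rewrite -leqn0 -E0 max_card.
by rewrite /quasitree_weight edgeless_vertices // !P0 eqxx !expr0 !mulr1.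
Qed.

(** The weight satisfies the identity that defines traffic independence, for every
    coloring: its support condition splits by [euler_CC], and its exponents add up
    because each edge lies in exactly one component. *)
Lemma quasitree_weight_CC (L : nat) (J : 'I_L -> Type) (T : lgraph {l : 'I_L & J l}) :
  quasitree_weight T =
  `[< tree (GCC T) >]%:R * \prod_(C : CC T) quasitree_weight (CC_graph C).
Proof.
have [E0|edges] := posnP #|edge T|.
  have noC (C : CC T) : False.
    by have [e _] := CC_nonempty C; have := card0_eq E0 e; rewrite inE.
  rewrite big_pred0 ?mulr1 => [|C]; last by case: (noC C).
  rewrite quasitree_weight_edgeless // asboolT //; split.
    apply/linkedP => -[C|x]; first by case: (noC C).
    by have /card_gt1P[C] := valP x; case: (noC C).
  by case=> [|[e b] s] //; case: (noC (val e).1).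
have bE : \prod_(C : CC T) (#|vertex (CC_graph C)| == #|@nonloops (CC_graph C)|.+1)%:R =
    [forall C : CC T, #|vertex (CC_graph C)| == #|@nonloops (CC_graph C)|.+1]%:R :> K.
  case: (boolP (FiniteQuant.quant0b _)) => [/forallP all|].
    by rewrite big1 // => C _; rewrite all.
  rewrite negb_forall => /existsP[C nC].
  by rewrite (bigD1 C) //= (negPf nC) mul0r.
rewrite /quasitree_weight !big_split /= bE !prodrXr [RHS]mulrA -natrM mulnb -euler_CC //.
congr (_ * (_ ^+ _ * _ ^+ _)).
  by rewrite -[LHS](card_edges_CC (@loops T)); apply: eq_bigr => C _; apply: eq_card.
by rewrite -[LHS](card_edges_CC (@nonloops T)); apply: eq_bigr => C _; apply: eq_card.
Qed.

End Weight.

(** * Edges labeled by the unit *)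

Section DeleteLoop.

Definition del_digraph (G : digraph) (e0 : edge G) : digraph :=
  @Digraph (vertex G) {e : edge G | e != e0}
    (fun k => src (val k)) (fun k => tgt (val k)).

Lemma del_connected (G : graph) (e0 : edge G) :
  src e0 = tgt e0 -> Defs.connected (del_digraph e0).
Proof.
move=> loop0; apply/andP; split; first exact: graph_gt0.
apply/linkedP => x y; move: (graph_connect x y).
apply: (@connect_map _ _ _ _ id) => {}x {}y /existsP[e exy].
have [e_e0|ne] := eqVneq e e0.
  suff -> : x = y by apply: connect0.
  by move: exy; rewrite e_e0 loop0 => /orP[] /andP[/eqP<- /eqP<-].
apply/connect1/existsP.
by exists (exist (fun e => e != e0) e ne : edge (del_digraph e0)).
Qed.

Definition del_loop (G : graph) (e0 : edge G) (loop0 : src e0 = tgt e0) : graph :=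
  Graph (del_connected loop0).

End DeleteLoop.

Section UnitEdge.
Variables (K : fieldType) (A : traffic_space K).
Implicit Types (G : graph).

(* Substituting the graph operation without edges for [e0] contracts [e0]. *)
Local Notation contract G l e0 := (@lsubst1 A (@LGraph A G l) e0 point_op (@of_void A)).

Let cvertex G (l : edge G -> A) (e0 : edge G) (x : vertex G) : vertex (contract G l e0) :=
  block_of (glue_part (@subst1_rel G e0 point_op)) (inl x).

Lemma tau_contract G (l : edge G -> A) (e0 : edge G) :
  l e0 = gunit A -> tau (@LGraph A G l) = tau (contract G l e0).
Proof.
move=> le0; rewrite -tau_subst; congr (tau (LGraph _)); apply: funext => e /=.
by case: eqP => // ->.
Qed.

Lemma contract_surj G (l : edge G -> A) (e0 : edge G) (w : vertex (contract G l e0)) :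
  exists x, @cvertex G l e0 x = w.
Proof.
have [[x|[]] <-] := block_of_surj w; first by exists x.
by exists (src e0); apply: glue_part_eq; rewrite /subst1_rel !eqxx.
Qed.

Lemma contract_src_tgt G (l : edge G -> A) (e0 : edge G) :
  @cvertex G l e0 (src e0) = @cvertex G l e0 (tgt e0).
Proof.
transitivity (block_of (glue_part (@subst1_rel G e0 point_op)) (inr tt)).
  by apply: glue_part_eq; rewrite /subst1_rel !eqxx.
by apply/esym/glue_part_eq; rewrite /subst1_rel !eqxx orbT.
Qed.

Lemma contract_sound G (l : edge G -> A) (e0 : edge G) (W : Type) (F : vertex G -> W) x y :
  F (src e0) = F (tgt e0) -> @cvertex G l e0 x = @cvertex G l e0 y -> F x = F y.
Proof.
move=> F0.
pose F' (z : (vertex G + unit)%type) := if z is inl z then F z else F (src e0).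
apply: (@glue_part_sound _ _ _ F') => u v /orP[] /andP[/eqP-> /eqP->] //.
Qed.

Lemma tau_del_loop G (l : edge G -> A) (e0 : edge G) (loop0 : src e0 = tgt e0) :
  l e0 = gunit A ->
  tau (@LGraph A G l) = tau (@LGraph A (del_loop loop0) (fun e => l (val e))).
Proof.
move=> le0; rewrite (tau_contract le0); apply/esym/tauI.
apply: (@lgraph_iso_kernel _ (@LGraph A (del_loop loop0) (fun e => l (val e)))
  (contract G l e0) (vertex G) id (@cvertex G l e0) inl
  (fun e => src (val e)) (fun e => tgt (val e))) => //.
- by move=> w; exists w.
- exact: contract_surj.
- by move=> x y; apply/eqP/eqP => [->//|]; apply: (@contract_sound G l e0 _ id).
- by exists (fun k => match k with inl e => e | inr v => of_void _ v end) => // -[].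
Qed.

(** Erasing a loop commutes with taking quotients, so the recursion that defines
    [tau0] gives the same values before and after. *)
Lemma tau0_del_loop G (l : edge G -> A) (e0 : edge G) (loop0 : src e0 = tgt e0) :
  l e0 = gunit A ->
  tau0 (@LGraph A G l) = tau0 (@LGraph A (del_loop loop0) (fun e => l (val e))).
Proof.
rewrite /tau0 /=; move: #|_| => n; elim: n G l e0 loop0 => // n IHn G l e0 loop0 le0 /=.
rewrite (tau_del_loop loop0 le0); congr (_ - _); apply: eq_bigr => P _.
have loopP : @src (quot P) e0 = @tgt (quot P) e0 by congr block_of.
rewrite [LHS](IHn (quot P) l e0 loopP le0); apply: tau0_recI.
exists id, id; split=> //; split=> //; try by exists id.
Qed.

(** Contracting [e0] does not change [tau], and the partitions of the contracted
    graph are the partitions that glue the endpoints of [e0].  These alone therefore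
    account for [tau], and the other terms of its expansion add up to [0]; by
    induction on the number of vertices, all of them but the finest one are [0]. *)
Lemma tau0_unit_nonloop G (l : edge G -> A) (e0 : edge G) :
  src e0 != tgt e0 -> l e0 = gunit A -> tau0 (@LGraph A G l) = 0.
Proof.
have [n] := ubnP #|vertex G|; elim: n G l e0 => // n IHn G l e0 ltn nl0 le0.
pose glued (P : vpart (vertex G)) := block_of P (src e0) == block_of P (tgt e0).
set T := LGraph l.
have gluedE : \sum_(P | glued P) tau0 (@lquot A T P) = tau T.
  rewrite (tau_contract le0) tau_sum_tau0.
  rewrite (eq_bigl (fun P : vpart (vertex G) => [forall x, forall y,
      (@cvertex G l e0 x == @cvertex G l e0 y) ==> (block_of P x == block_of P y)])).
    rewrite sum_ker_coarser; last exact: contract_surj.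
    apply: eq_bigr => Q _; set P := ker_part _.
    have loopP : @src (quot P) e0 = @tgt (quot P) e0.
      by apply/eqP; rewrite /= ker_partE contract_src_tgt.
    rewrite (@tau0_del_loop (quot P) l e0 loopP le0); apply: tau0I.
    apply: (@lgraph_iso_kernel _ (@LGraph A (del_loop loopP) (fun e => l (val e)))
       (@lquot A (contract G l e0) Q) (vertex G) (block_of P)
       (fun x => block_of Q (@cvertex G l e0 x)) inl
       (fun e => @src G (val e)) (fun e => @tgt G (val e))) => //.
    - exact: block_of_surj.
    - move=> w; have [v <-] := block_of_surj w.
      by have [x <-] := contract_surj v; exists x.
    - by move=> x y; rewrite ker_partE.
    - by exists (fun k => match k with inl e => e | inr v => of_void _ v end) => // -[].
  move=> P; apply/idP/forallP => [/eqP gP x|/(_ (src e0))/forallP/(_ (tgt e0))].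
    apply/forallP => y; apply/implyP => /eqP xy; apply/eqP.
    exact: (contract_sound gP xy).
  by rewrite contract_src_tgt eqxx.
have := tau_sum_tau0 T; rewrite (bigID glued) /= gluedE.
rewrite (bigD1 (discrete_part (vertex G))) /=; last first.
  by apply: contraNN nl0 => /eqP/block_of_discrete_inj->.
rewrite -(tau0I (lquot_discrete T)) big1 ?addr0.
  by rewrite -[X in X = _]addr0 => /addrI ->.
move=> P /andP[ngP dP]; apply: (IHn (quot P) l e0) => //.
rewrite (leq_trans _ (ltn : (_ <= n)%N)) //; apply: (@lquot_card A T P).
by apply: contraNneq dP => dP; apply/eqP/val_inj.
Qed.

End UnitEdge.

(** * Injective distribution of a combination of the unit and J *)

Section Inversion.
Variable K : fieldType.

(** [tau] determines [tau0] by Moebius inversion on the lattice of partitions. *)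
Lemma tau0_unique (A : traffic_space K) (x : A) (w : graph -> K) :
  (forall G H f h, @graph_iso (digraph_of G) (digraph_of H) f h -> w G = w H) ->
  (forall G, tau (@LGraph A G (fun=> x)) = \sum_(P : vpart (vertex G)) w (quot P)) ->
  forall G, tau0 (@LGraph A G (fun=> x)) = w G.
Proof.
move=> wI wE G; have [n] := ubnP #|vertex G|; elim: n G => // n IHn G ltn.
set T := LGraph _; have [f [h [fh _]]] := lquot_discrete T.
have := tau_sum_tau0 T; rewrite {1}/T wE.
rewrite (bigD1 (discrete_part _)) //= [RHS](bigD1 (discrete_part _)) //=.
rewrite -(tau0I (lquot_discrete T)) -(wI _ _ _ _ fh).
rewrite [X in _ = _ + X](eq_bigr (fun P => w (quot P))) => [/addIr ->//|P dP].
apply: (IHn (quot P)); rewrite (leq_trans _ (ltn : (_ <= n)%N)) //.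
by apply: (@lquot_card A T P); apply: contraNneq dP => dP; apply/eqP/val_inj.
Qed.

Lemma same_dist_tau0 (A B : traffic_space K) (x : A) (y : B) : same_dist x y ->
  forall G, tau0 (@LGraph A G (fun=> x)) = tau0 (@LGraph B G (fun=> y)).
Proof.
move=> xy; apply: tau0_unique => [G H f h fh|G].
  have [_ bh _ _] := fh.
  by apply: tau0I; exists f, h.
exact: etrans (xy (@LGraph unit G (fun=> tt))) (tau_sum_tau0 (@LGraph B G (fun=> y))).
Qed.

End Inversion.

Section Combination.
Variables (K : fieldType) (B : traffic_space K) (j : B).
Hypothesis hj : is_traffic_J j.

(** The unit edges are erased one by one; the formula for [J] gives what is left. *)
Lemma tau0_unit_or_J (G : graph) (c : edge G -> bool) :
  tau0 (@LGraph B G (fun e => if c e then gunit B else j)) =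
  ([forall e, c e ==> (src e == tgt e)] && (#|vertex G| == #|[pred e | ~~ c e]|.+1))%:R.
Proof.
have [n] := ubnP #|[pred e | c e]|; elim: n G c => // n IHn G c ltn.
have [e0 ce0|noc] := pickP c; last first.
  have -> : (fun e => if c e then gunit B else j) = (fun=> j).
    by apply: funext => e; rewrite noc.
  have [_ ->] := hj (@LGraph unit G (fun=> tt)).
  have /andP[V0 lG] := graphP G.
  have -> : [forall e, c e ==> (src e == tgt e)] by apply/forallP => e; rewrite noc.
  rewrite (eq_card (B := edge G)) => [|e]; last by rewrite !inE noc.
  by congr (nat_of_bool _)%:R; apply/asboolP/eqP => /tree_euler; apply.
have [loop0|nl0] := eqVneq (src e0) (tgt e0); last first.
  rewrite (tau0_unit_nonloop (e0 := e0)) ?ce0 //.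
  case: forallP => // /(_ e0); by rewrite ce0 (negPf nl0).
rewrite (tau0_del_loop loop0) ?ce0 //.
rewrite (IHn (del_loop loop0) (fun e => c (val e))); last first.
  rewrite (leq_trans _ (ltn : (_ <= n)%N)) //.
  rewrite (card_sub_pred (fun e => e != e0) c) [ltnRHS](cardD1 e0) inE ce0 add1n ltnS.
  by apply/eq_leq/eq_card => e; rewrite !inE.
congr (nat_of_bool (_ && _))%:R.
  apply/forallP/forallP => h e; last exact: h.
  have [->|ne] := eqVneq e e0; first by rewrite loop0 eqxx implybT.
  exact: (h (exist (fun e => e != e0) e ne)).
congr (_ == _.+1).
rewrite (card_sub_pred (fun e => e != e0) (fun e => ~~ c e)); apply: eq_card => e.
by rewrite !inE; case: eqP => // ->; rewrite ce0.
Qed.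

(** The unit is allowed on loops only, and with fewer units than loops there are too
    many edges left for a tree: the only contribution comes from the coloring [c0]
    that puts the unit on all the loops. *)
Lemma sum_unit_or_J (alpha beta : K) (G : graph) :
  \sum_(c : {ffun edge G -> bool}) (\prod_e (if c e then alpha else beta)) *
    ([forall e, c e ==> (src e == tgt e)] && (#|vertex G| == #|[pred e | ~~ c e]|.+1))%:R
  = quasitree_weight alpha beta G.
Proof.
pose c0 : {ffun edge G -> bool} := [ffun e => src e == tgt e].
rewrite (bigD1 c0) //= [X in _ + X]big1 ?addr0 => [|c cc0].
  rewrite mulrC /quasitree_weight; congr (_ * _).
    have -> : [forall e, c0 e ==> (src e == tgt e)] by apply/forallP => e; rewrite ffunE implybb.
    congr (nat_of_bool (_ == _.+1))%:R; apply: eq_card => e; by rewrite !inE ffunE.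
  rewrite (bigID (@loops G)) /=; congr (_ * _).
    by rewrite -prodr_const; apply: eq_bigr => e el; rewrite ffunE -/(loops e) el.
  rewrite -prodr_const; apply: eq_big => e; first by [].
  by rewrite ffunE -/(loops e) => /negPf->.
case: andP => [[/forallP cl /eqP cV]|_]; last by rewrite mulr0.
have /andP[V0 lG] := graphP G; have [r _] := card_gt0P V0.
have := linked_euler r lG; rewrite cV ltnS => le.
have sub : [pred e : edge G | src e != tgt e] \subset [pred e | ~~ c e].
  by apply/fintype.subsetP => e; rewrite !inE; apply: contra => ce; have := cl e; rewrite ce.
have /subset_cardP/(_ sub) eqc : #|[pred e : edge G | src e != tgt e]| = #|[pred e | ~~ c e]|.
  by apply/eqP; rewrite eqn_leq le subset_leq_card.
case/eqP: cc0; apply/ffunP => e; rewrite ffunE; apply: negb_inj.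
by have := eqc e; rewrite !inE.
Qed.

Lemma tau_combination (alpha beta : K) (G : graph) :
  tau (@LGraph B G (fun=> alpha *: gunit B + beta *: j)) =
  \sum_(P : vpart (vertex G)) quasitree_weight alpha beta (quot P).
Proof.
have -> : (fun=> alpha *: gunit B + beta *: j) = (fun=> \sum_(b : bool)
    (if b then alpha else beta) *: (if b then gunit B else j)) :> (edge G -> B).
  by apply: funext => e; rewrite big_bool.
rewrite (multilinear_sum (F := fun l => tau (@LGraph B G l)) _ true); last exact: tauD.
transitivity (\sum_(c : {ffun edge G -> bool}) \sum_(P : vpart (vertex G))
    (\prod_e (if c e then alpha else beta)) *
    ([forall e : edge (quot P), c e ==> (src e == tgt e)] &&
     (#|vertex (quot P)| == #|[pred e | ~~ c e]|.+1))%:R).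
  apply: eq_bigr => c _; rewrite -mulr_sumr; congr (_ * _).
  rewrite tau_sum_tau0; apply: eq_bigr => P _.
  exact: (@tau0_unit_or_J (quot P) c).
rewrite exchange_big; apply: eq_bigr => P _; exact: (sum_unit_or_J alpha beta (quot P)).
Qed.

Lemma same_dist_combination (A : traffic_space K) (x : A) (alpha beta : K) :
  same_dist x (alpha *: gunit B + beta *: j) <->
  forall G, tau0 (@LGraph A G (fun=> x)) = quasitree_weight alpha beta G.
Proof.
split=> [/same_dist_tau0 xb G|x0 T].
  rewrite xb; apply: (tau0_unique (w := fun H : graph => quasitree_weight alpha beta H)).
    by move=> G' H f h; apply: quasitree_weight_iso.
  exact: tau_combination.
rewrite /traffic_dist1 /traffic_dist /lgraph_map tau_combination tau_sum_tau0.
apply: eq_bigr => P _; exact: (x0 (quot P)).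
Qed.

End Combination.

(** * Elements independent from themselves *)

Section OneEdge.
Variables (K : fieldType) (A : traffic_space K) (x : A).

Lemma tau0_one_vertex (T : lgraph A) : #|vertex T| = 1%N -> tau0 T = tau T.
Proof. by move=> V1; rewrite /tau0 V1 /= big1 // subr0. Qed.

Lemma tau0_one_loop (G : graph) : #|vertex G| = 1%N -> #|edge G| = 1%N ->
  tau0 (@LGraph A G (fun=> x)) = Phi x.
Proof.
move=> V1 E1; rewrite tau0_one_vertex //; apply: tauI.
exists (fun=> tt), (fun=> tt); split=> //; split=> //; apply: inj_card_bij.
- by move=> u v _; apply: (fintype_le1P _ _ _); rewrite V1.
- by rewrite V1 card_unit.
- by move=> u v _; apply: (fintype_le1P _ _ _); rewrite E1.
- by rewrite E1 card_unit.
Qed.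

(** The degree of [x] is the edge operation with both ends at its target, so a loop
    labeled [gdeg x] unfolds to a single edge labeled [x]. *)
Lemma tau_edge : tau (@LGraph A edge_graph (fun=> x)) = Psi x.
Proof.
rewrite /Psi /Phi; set T := LGraph _.
have -> : (fun=> gdeg x) = [eta (fun=> x) with tt |-> @gact K A deg_op (fun=> x)].
  by apply: funext => -[].
rewrite tau_subst; apply: tauI; set T' := lsubst1 _ _.
pose q (b : bool) : vertex T' := block_of (glue_part (@subst1_rel loop_graph tt deg_op)) (inr b).
apply: (@lgraph_iso_kernel _ T T' bool id q inr (fun=> false) (fun=> true)) => //.
- by move=> w; exists w.
- move=> w; have [[[]|b] <-] := block_of_surj w; last by exists b.
  by exists true; apply/esym/glue_part_eq; rewrite /subst1_rel !eqxx.
- move=> b b'; apply/eqP/eqP => [->//|].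
  pose F (z : (unit + bool)%type) := if z is inr b then b else true.
  by apply: (@glue_part_sound _ _ _ F) => u v /orP[] /andP[/eqP-> /eqP->].
- by exists (fun=> tt) => [[]//|[[[]//]|[]]].
Qed.

(** The two-element vertex set has two partitions, and the coarse one turns the edge
    into a loop. *)
Lemma tau0_edge : tau0 (@LGraph A edge_graph (fun=> x)) = Psi x - Phi x.
Proof.
set T := LGraph _; pose d := discrete_part (vertex T); pose t := ker_part (fun _ : vertex T => tt).
have td : t != d.
  apply/eqP => td; suff : false = true by [].
  by apply: (@block_of_discrete_inj bool); rewrite -/d -td; apply/eqP; rewrite ker_partE.
have tauP (P : vpart bool) : P = t \/ P = d.
  case E : (block_of P false == block_of P true); [left | right]; apply: vpart_ext.
    by move=> u v; rewrite ker_partE eqxx; case: u v => -[]; rewrite ?eqxx // eq_sym.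
  move=> u v; rewrite (inj_eq (@block_of_discrete_inj _)).
  by case: u v => -[]; rewrite ?eqxx // eq_sym.
have := tau_sum_tau0 T; rewrite tau_edge (bigD1 d) //= (bigD1 t) //= big1 ?addr0; last first.
  by move=> P /andP[Pd Pt]; case: (tauP P) => PE; rewrite PE eqxx in Pd Pt.
rewrite -(tau0I (lquot_discrete T)) => ->.
rewrite [tau0 (lquot t)](@tau0_one_loop (quot t)) ?addrK //; last by rewrite card_unit.
apply/eqP; rewrite eqn_leq graph_gt0 andbT; apply/fintype_le1P => B B'.
have [u <-] := block_of_surj B; have [v <-] := block_of_surj B'.
by apply/eqP; rewrite ker_partE.
Qed.

Lemma tau0_le1_edge (G : graph) : (#|edge G| <= 1)%N ->
  tau0 (@LGraph A G (fun=> x)) = quasitree_weight (Phi x) (Psi x - Phi x) G.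
Proof.
rewrite leq_eqVlt => /orP[/eqP E1|]; last first.
  rewrite ltnS leqn0 => /eqP E0; rewrite quasitree_weight_edgeless //.
  by rewrite tau0_one_vertex ?tau_noedge // edgeless_vertices.
have /andP[V0 lG] := graphP G; have [r _] := card_gt0P V0.
have [e eP] := mem_card1 E1; have le := linked_euler r lG.
have uniqe e' : e' = e by apply/eqP; have := eP e'; rewrite !inE => <-.
have cP (P : pred (edge G)) : #|P| = P e.
  rewrite card_sum_bool (bigD1 e) //= big1 ?addn0 // => e' e'e.
  by rewrite (uniqe e') eqxx in e'e.
rewrite (cP (fun e => src e != tgt e)) in le.
rewrite /quasitree_weight !cP /loops /nonloops; case: eqVneq le => /= [loope|nl] le.
  have V1 : #|vertex G| = 1%N by apply/eqP; rewrite eqn_leq le.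
  by rewrite tau0_one_loop // V1 eqxx mulr1 mul1r.
have V2 : #|vertex G| = 2%N.
  by apply/eqP; rewrite eqn_leq le; apply/card_gt1P; exists (src e), (tgt e).
rewrite V2 eqxx expr0 expr1 !mul1r -tau0_edge; apply/esym/tau0I.
exists (fun b => if b then tgt e else src e), (fun=> e); split=> //; split=> //.
  apply: inj_card_bij; last by rewrite [leqLHS]V2 card_bool.
  by move=> [] [] // E; rewrite E eqxx in nl.
apply: inj_card_bij; first by do 2!case.
by rewrite [leqLHS]E1 card_unit.
Qed.

(** Independence determines [tau0] by induction on the number of edges, through
    colorings for which no component contains all the edges; as the weight obeys the
    same identity, it is the solution. *)
Lemma self_independentP : self_independent x <->
  forall G, tau0 (@LGraph A G (fun=> x)) = quasitree_weight (Phi x) (Psi x - Phi x) G.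
Proof.
split=> [ind G|xw ev T]; last first.
  rewrite [LHS](xw T) quasitree_weight_CC; congr (_ * _).
  by apply: eq_bigr => C _; rewrite [RHS](xw (CC_graph C)).
have [n] := ubnP #|edge G|; elim: n G => // n IHn G ltn.
have [le1|gt1] := leqP #|edge G| 1%N; first exact: tau0_le1_edge.
have /card_gt1P[e0 [e1 [_ _ e01]]] := gt1.
pose T := @LGraph {l : 'I_2 & unit} G
  (fun e => existT (fun=> unit) (if e == e0 then ord0 else ord_max) tt).
rewrite (ind T : tau0 (@LGraph A G (fun=> x)) = _).
rewrite [RHS](quasitree_weight_CC _ _ T); congr (_ * _); apply: eq_bigr => C _.
apply: (IHn (CC_graph C)); rewrite (leq_trans _ (ltn : (_ <= n)%N)) // card_sig.
have /andP[mC _] := valP C; have [l lP] := monochromatic_color mC.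
apply: proper_card; apply/properP; split; first exact/fintype.subsetP.
case e0C : (e0 \in (val (val C)).2); last by exists e0; rewrite ?inE ?e0C.
exists e1 => //; rewrite inE; apply/negP => e1C.
by have := lP _ e0C; rewrite -(lP _ e1C) /= eqxx eq_sym (negPf e01).
Qed.

End OneEdge.

(** * Means of independent elements *)

Section LawOfLargeNumbers.
Variables (K : numFieldType) (A : traffic_space K) (a_ : nat -> A) (a : A).
Hypotheses (indep : independent_seq a_) (ident : forall n, same_dist (a_ n) a).

Definition colored (n : nat) (G : graph) (c : edge G -> 'I_n) : lgraph {l : 'I_n & unit} :=
  @LGraph {l : 'I_n & unit} G (fun e => existT (fun=> unit) (c e) tt).

(** Inside a component all the labels are the same [a_ l], which may be replaced by
    [a]: the only trace of the coloring left in the factors is how it cuts [G]. *)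
Lemma tau0_colored (n : nat) (G : graph) (c : edge G -> 'I_n) :
  tau0 (@LGraph A G (fun e => a_ (c e))) =
  `[< tree (GCC (colored c)) >]%:R *
    \prod_(C : CC (colored c)) tau0 (@LGraph A (CC_graph C) (fun=> a)).
Proof.
rewrite (indep (colored c) : tau0 (@LGraph A G (fun e => a_ (c e))) = _).
congr (_ * _); apply: eq_bigr => C _; have /andP[mC _] := valP C.
have [l lP] := monochromatic_color mC.
rewrite -(same_dist_tau0 (ident l)); congr (tau0 (LGraph _)).
by apply: funext => e /=; rewrite -(lP _ (valP e)).
Qed.

(** With distinct colors the components are single edges. *)
Lemma tau0_injective_coloring (n : nat) (G : graph) (c : edge G -> 'I_n) : injective c ->
  tau0 (@LGraph A G (fun e => a_ (c e))) = quasitree_weight (Phi a) (Psi a - Phi a) G.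
Proof.
move=> c_inj; rewrite tau0_colored [RHS](quasitree_weight_CC _ _ (colored c)).
congr (_ * _); apply: eq_bigr => C _; apply: tau0_le1_edge.
have /andP[mC _] := valP C; have [l lP] := monochromatic_color mC.
have cl (e : edge (CC_graph C)) : c (val e) = l by apply: (lP _ (valP e)).
by apply/fintype_le1P => e e'; apply/val_inj/c_inj; rewrite !cl.
Qed.

(* A total function of digraphs: finite products over all subgraphs are taken below,
   and not all of them are connected. *)
Let tau0_of (D : digraph) : K :=
  if @idP (Defs.connected D) is ReflectT cD then tau0 (@LGraph A (Graph cD) (fun=> a)) else 0.

Let tau0_ofE (G : graph) : tau0_of G = tau0 (@LGraph A G (fun=> a)).
Proof.
rewrite /tau0_of; case: {-}_ / idP => [cD|]; last by rewrite (graphP G).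
by case: G cD => D pD cD; rewrite (bool_irrelevance cD pD).
Qed.

Lemma sub_digraph_color (n n' : nat) (G : graph) (c : edge G -> 'I_n) (c' : edge G -> 'I_n')
    (S : subgraph (colored c)) :
  @sub_digraph _ _ (colored c) S = @sub_digraph _ _ (colored c') S.
Proof.
by congr Digraph; apply: funext => e; apply: val_inj.
Qed.

(** The factors are indexed by subgraphs of [G] and their values do not depend on
    the colors, so they are bounded uniformly in the coloring. *)
Lemma tau0_colored_bounded (G : graph) : exists M : K,
  forall n (c : edge G -> 'I_n), `|tau0 (@LGraph A G (fun e => a_ (c e)))| <= M.
Proof.
pose c0 : edge G -> 'I_1 := fun=> ord0.
exists (\prod_(S : subgraph (colored c0)) (1 + `|tau0_of (sub_digraph S)|)) => n c.
rewrite tau0_colored normrM; apply: (@le_trans _ _ (\prod_(C : CC (colored c))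
    `|tau0_of (sub_digraph (val C))|)).
  rewrite normr_prod -[leRHS]mul1r ler_pM ?prodr_ge0 //; last first.
    by apply: ler_prod => C _; rewrite normr_ge0 (tau0_ofE (CC_graph C)) lexx.
  by case: asboolP; rewrite ?normr0 ?normr1 ?ler01 ?lexx.
rewrite -(big_sub (@colored_component _ _ (colored c)) (fun S => `|tau0_of (sub_digraph S)|)).
rewrite big_mkcond; apply: ler_prod => S _.
rewrite (sub_digraph_color c0).
by case: ifP => _; rewrite ?ler01 ?normr_ge0 ?lexx ?lerDl ?lerDr ?ler01 ?normr_ge0.
Qed.

Lemma tau_colored_bounded (G : graph) : exists M : K,
  forall n (c : edge G -> 'I_n), `|tau (@LGraph A G (fun e => a_ (c e)))| <= M.
Proof.
have [M MP] := choice (fun P : vpart (vertex G) => tau0_colored_bounded (quot P)).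
exists (\sum_P M P) => n c; rewrite tau_sum_tau0.
apply: le_trans (ler_norm_sum _ _ _) _; apply: ler_sum => P _.
exact: (MP P n c).
Qed.

(** The proportion [n ^_ k / n ^ k] of injective maps is at least [1 - k ^ 2 / n]; the
    inequality is multiplied by [n] to stay among natural numbers. *)
Lemma ffact_expn (n k : nat) : (n * n ^ k <= n * n ^_ k + k ^ 2 * n ^ k)%N.
Proof.
elim: k => [|k IHk]; first by rewrite expn0 ffactn0 mul0n addn0.
rewrite expnS ffactnSr.
have [kn|nk] := leqP k n; last by rewrite ffact_small //; nia.
nia.
Qed.

Lemma mean_expand (n : nat) (G : graph) : (0 < n)%N ->
  tau (@LGraph A G (fun=> n%:R^-1 *: \sum_(k < n) a_ k)) =
  n%:R^-1 ^+ #|edge G| *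
    \sum_(c : {ffun edge G -> 'I_n}) tau (@LGraph A G (fun e => a_ (c e))).
Proof.
move=> n_gt0; rewrite scaler_sumr.
rewrite (multilinear_sum (F := fun l => tau (@LGraph A G l)) _ (Ordinal n_gt0)
  (fun=> n%:R^-1) (fun k => a_ k)); last exact: tauD.
by rewrite mulr_sumr; apply: eq_bigr => c _; rewrite prodr_const.
Qed.

Lemma card_noninjective (n : nat) (E : finType) :
  (n * #|[pred c : {ffun E -> 'I_n} | ~~ injectiveb c]| <= #|E| ^ 2 * n ^ #|E|)%N.
Proof.
have := cardsC [set c : {ffun E -> 'I_n} | injectiveb c].
rewrite card_inj_ffuns card_ffun card_ord => cE.
rewrite (eq_card (B := ~: [set c : {ffun E -> 'I_n} | injectiveb c])) => [|c].
  by rewrite -(leq_add2l (n * n ^_ #|E|)) -mulnDr cE ffact_expn.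
by rewrite !inE.
Qed.

(** The injective colorings give exactly the limit, so the error comes from the
    others, and [card_noninjective] bounds their proportion. *)
Lemma mean_bound (G : graph) : exists2 C : K, 0 <= C & forall n, (0 < n)%N ->
  `|tau (@LGraph A G (fun=> n%:R^-1 *: \sum_(k < n) a_ k)) -
    \sum_(P : vpart (vertex G)) quasitree_weight (Phi a) (Psi a - Phi a) (quot P)| <=
  C / n%:R.
Proof.
set t := \sum_P _; have [M MP] := tau_colored_bounded G.
have M0 : 0 <= M by apply: le_trans (MP 1%N (fun=> ord0)); apply: normr_ge0.
have B0 : 0 <= M + `|t| by rewrite addr_ge0.
set k := #|edge G|; exists ((k ^ 2)%:R * (M + `|t|)) => [|n n_gt0].
  by rewrite mulr_ge0 ?ler0n.
have n0 : 0 < n%:R :> K by rewrite ltr0n.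
have nk0 : 0 < n%:R ^+ k :> K by rewrite exprn_gt0.
have tE : t = n%:R^-1 ^+ k * \sum_(c : {ffun edge G -> 'I_n}) t.
  rewrite sumr_const card_ffun card_ord -/k -[t *+ _]mulr_natl mulrA natrX exprVn.
  by rewrite mulVf ?mul1r // gt_eqF.
rewrite mean_expand // {1}tE -mulrBr -sumrB normrM exprVn -/k.
rewrite (ger0_norm (_ : 0 <= (n%:R ^+ k)^-1)) ?invr_ge0 ?(ltW nk0) //.
rewrite mulrC ler_pdivrMr // mulrAC ler_pdivlMr //.
apply: (@le_trans _ _ (#|[pred c : {ffun edge G -> 'I_n} | ~~ injectiveb c]|%:R
    * (M + `|t|) * n%:R)).
  rewrite ler_pM2r //; apply: le_trans (ler_norm_sum _ _ _) _.
  rewrite mulr_natl -sumr_const [leRHS]big_mkcond; apply: ler_sum => c _.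
  rewrite inE; case: (boolP (injectiveb c)) => [/injectiveP c_inj|_] /=.
    rewrite tau_sum_tau0 -sumrB big1 ?normr0 // => P _.
    by apply/eqP; rewrite subr_eq0; apply/eqP/(@tau0_injective_coloring n (quot P) c c_inj).
  by rewrite (le_trans (ler_normB _ _)) // lerD2r.
rewrite mulrAC [leRHS]mulrAC ler_wpM2r //.
by rewrite -natrX -!natrM ler_nat mulnC card_noninjective.
Qed.

End LawOfLargeNumbers.

(** * Convergence *)

(** The order of [R[i]] compares only numbers with the same imaginary part, so that
    [C] and [e] are real here. *)
Lemma complex_archimedean (R : realType) (C e : R[i]) : 0 <= C -> 0 < e ->
  exists N : nat, C <= N%:R * e.
Proof.
case: C => C C'; case: e => e e'; rewrite lecE ltcE /= => /andP[/eqP -> C0] /andP[/eqP -> e0].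
exists (Num.Def.truncn (C / e)).+1.
rewrite -(rmorph_nat (real_complex R)) lecE /= !mul0r mulr0 addr0 eqxx /= subr0.
by rewrite -ler_pdivrMr // ltW // truncnS_gt.
Qed.

Lemma cvg_of_bound (R : realType) (u : nat -> R[i]) (l C : R[i]) : 0 <= C ->
  (forall n, (0 < n)%N -> `|u n - l| <= C / n%:R) ->
  ((u : nat -> R[i]^o) @ \oo --> (l : R[i]^o))%classic.
Proof.
move=> C0 uC; apply/cvgrPdist_le => e e0.
have [N CN] := complex_archimedean C0 e0.
exists N.+1 => // n /= Nn; rewrite distrC.
have n0 : (0 < n)%N by apply: leq_trans Nn.
apply: le_trans (uC n n0) _; rewrite ler_pdivrMr ?ltr0n // mulrC.
apply: le_trans CN _; rewrite ler_wpM2r ?(ltW e0) // ler_nat.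
exact: ltnW.
Qed.

Local Open Scope classical_set_scope.

Theorem proposition6p1 (R : realType) (A : traffic_space R[i])
    (B : traffic_space R[i]) (j : B) (hj : is_traffic_J j) :
  (forall a : A,
     self_independent a <->
     same_dist a (Phi a *: gunit B + (Psi a - Phi a) *: j)) /\
  (forall (a_ : nat -> A) (a : A),
     independent_seq a_ ->
     (forall n : nat, same_dist (a_ n) a) ->
     forall T : lgraph unit,
       (fun n : nat => traffic_dist1 (n%:R^-1 *: \sum_(k < n) a_ k) T : R[i]^o) @ \oo -->
       (traffic_dist1 (Phi a *: gunit B + (Psi a - Phi a) *: j) T : R[i]^o)).
Proof.
split=> [a|a_ a indep ident T].
  exact: iff_trans (self_independentP a) (iff_sym (same_dist_combination hj a _ _)).
have [C C0 meanC] := mean_bound indep ident T.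
apply: (cvg_of_bound C0) => n n_gt0.
by rewrite {2}/traffic_dist1 /traffic_dist tau_combination // meanC.
Qed.
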